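(* (i) Let $(\Omega,\mathcal F,\mathbb P,(\mathcal F_t)_{t\ge 0})$ be a filtered probability space satisfying the usual conditions. Let $X=(X_t)_{t\ge0}$ and $G=(G_t)_{t\ge0}$ be non-decreasing, non-negative, adapted, right-continuous processes, and let $G$ be in addition predictable, such that $\mathbb E[X_\tau\mid\mathcal F_0]\le\mathbb E[G_\tau\mid\mathcal F_0]\le\infty$ for every bounded stopping time $\tau$. Then for all $p\in(0,1)$, $$\mathbb E\Big[\Big(\sup_{t\ge0}X_t\Big)^p\,\Big|\,\mathcal F_0\Big]\le p^{-p}\,\mathbb E\Big[\Big(\sup_{t\ge0}G_t\Big)^p\,\Big|\,\mathcal F_0\Big].$$ (ii) Furthermore, for every $p\in(0,1)$ there exist a filtered probability space satisfying the usual conditions and, on it, continuous processes $\tilde X=(\tilde X_t)_{t\ge0}$ and $\tilde G=(\tilde G_t)_{t\ge0}$ satisfying all the assumptions imposed on $X$ and $G$ in (i), such that $$p^{-p}=\lim_{n\to\infty}\frac{\mathbb E\big[\big(\sup_{t\ge0}\tilde X_{t\wedge n}\big)^p\big]}{\mathbb E\big[\big(\sup_{t\ge0}\tilde G_{t\wedge n}\big)^p\big]}.$$ In particular, the constant $p^{-p}$ in (i) is sharp, i.e. it cannot be replaced by any smaller constant.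
   Context: All processes are real-valued. Usual conditions: the filtration is right-continuous and $\mathcal F_0$ contains all $\mathbb P$-null sets of the completed $\sigma$-algebra $\mathcal F$. Predictable means measurable with respect to the $\sigma$-algebra on $[0,\infty)\times\Omega$ generated by the left-continuous adapted processes. Conditional expectations of non-negative random variables take values in $[0,\infty]$. Notation: $s\wedge t=\min(s,t)$. *)

(* Defs.v *)
From HB Require Import structures.
From mathcomp Require Import all_boot all_order all_algebra.
From mathcomp Require Import all_classical all_reals all_analysis.
From mathcomp Require Import measurable_realfun.

Set Implicit Arguments.
Unset Strict Implicit.
Unset Printing Implicit Defensive.
Import Order.TTheory GRing.Theory Num.Theory.
Import numFieldNormedType.Exports.
Local Open Scope classical_set_scope.
Local Open Scope ring_scope.

(* Processes and filtrations are functions of t : R of which only the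
   restriction to [0, +oo[ matters: nothing is required for t < 0. *)

Section filtered_spaces.
Context d (T : measurableType d) (R : realType).
Implicit Types (P : probability T R) (F : R -> set (set T)).
Implicit Types (X Y : R -> T -> R) (tau : T -> R) (p : R).

Record filtration F : Prop := Filtration {
  filtration_sigma : forall t, 0 <= t -> sigma_algebra setT (F t);
  filtration_measurable : forall t, 0 <= t -> F t `<=` measurable;
  filtration_nondecreasing : forall s t, 0 <= s -> s <= t -> F s `<=` F t }.

(* [P.-negligible] is the class of all subsets of measurable P-null sets, i.e.
   the null sets of the completion. Together with [F 0 `<=` measurable], the
   last field makes the underlying probability space complete. *)
Record usual_conditions P F : Prop := UsualConditions {
  usual_filtration : filtration F;
  usual_right_continuous :
    forall t, 0 <= t -> \bigcap_(s in [set s | t < s]) F s = F t;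
  usual_complete : P.-negligible `<=` F 0 }.

Definition measurable_wrt d' (S : measurableType d') (H : set (set T))
    (f : T -> S) : Prop :=
  measurable_fun [set: g_sigma_algebraType H] (f : g_sigma_algebraType H -> S).

Definition adapted F X : Prop :=
  forall t, 0 <= t -> measurable_wrt (F t) (X t).

Definition nonnegative X : Prop := forall t w, 0 <= t -> 0 <= X t w.

Definition nondecreasing X : Prop :=
  forall s t w, 0 <= s -> s <= t -> X s w <= X t w.

Definition right_continuous X : Prop :=
  forall t w, 0 <= t -> X s w @[s --> t^'+] --> X t w.

(* Left-continuity at time 0 is void. *)
Definition left_continuous X : Prop :=
  forall t w, 0 < t -> X s w @[s --> t^'-] --> X t w.

Definition continuous_paths X : Prop :=
  forall w, {within `[0, +oo[, continuous (X ^~ w)}.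

Definition time_space : set (R * T) := `[0, +oo[ `*` [set: T].

Definition process_sets X : set (set (R * T)) :=
  preimage_set_system time_space (fun z => X z.1 z.2) measurable.

Definition predictable_sets F : set (set (R * T)) :=
  <<s time_space, \bigcup_(Y in [set Y | left_continuous Y /\ adapted F Y])
                    process_sets Y >>.

Definition predictable F X : Prop := process_sets X `<=` predictable_sets F.

Definition bounded_stopping_time F tau : Prop :=
  [/\ forall w, 0 <= tau w,
      forall t, 0 <= t -> F t [set w | tau w <= t]
    & exists C : R, forall w, tau w <= C].

Definition at_time X tau : T -> \bar R := fun w => (X (tau w) w)%:E.

Definition stopped X (c : R) : R -> T -> R := fun t => X (Num.min t c).

Definition sup_process X : T -> \bar R :=
  fun w => ereal_sup [set (X t w)%:E | t in `[0, +oo[].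

Definition sup_power p X : T -> \bar R := fun w => (sup_process X w `^ p)%E.

Definition is_cond_exp P (H : set (set T)) (U V : T -> \bar R) : Prop :=
  [/\ measurable_wrt H V,
      forall w, (0 <= V w)%E
    & forall A, H A -> (\int[P]_(w in A) V w = \int[P]_(w in A) U w)%E].

(* Conditional expectation of a nonnegative measurable U given a sub-sigma-
   algebra H: an arbitrary version, unique up to P-null sets. It exists by
   Radon-Nikodym, so the default value of [xget] is immaterial. *)
Definition cond_exp P (H : set (set T)) (U : T -> \bar R) : T -> \bar R :=
  xget (cst 0%E) [set V | is_cond_exp P H U V].

Record dominated_pair P F X G : Prop := DominatedPair {
  dominated_X_nondecreasing : nondecreasing X;
  dominated_X_nonnegative : nonnegative X;
  dominated_X_adapted : adapted F X;
  dominated_X_right_continuous : right_continuous X;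
  dominated_G_nondecreasing : nondecreasing G;
  dominated_G_nonnegative : nonnegative G;
  dominated_G_adapted : adapted F G;
  dominated_G_right_continuous : right_continuous G;
  dominated_G_predictable : predictable F G;
  dominated_domination : forall tau, bounded_stopping_time F tau ->
    \forall w \ae P,
      (cond_exp P (F 0%R) (at_time X tau) w <=
       cond_exp P (F 0%R) (at_time G tau) w)%E }.

Definition moment_inequality P F X G p (c : R) : Prop :=
  \forall w \ae P,
    (cond_exp P (F 0%R) (sup_power p X) w <=
     c%:E * cond_exp P (F 0%R) (sup_power p G) w)%E.

Definition stopped_sup_moment P X p (n : nat) : \bar R :=
  (\int[P]_w sup_power p (stopped X n%:R%R) w)%E.

End filtered_spaces.

(* Main.v *)
From HB Require Import structures.
From mathcomp Require Import all_boot all_order all_algebra.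
From mathcomp Require Import all_classical all_reals all_analysis.
From mathcomp Require Import measurable_realfun.
From mathcomp Require Import ring lra.
Require Import Defs.

Set Implicit Arguments.
Unset Strict Implicit.
Unset Printing Implicit Defensive.
Import Order.TTheory GRing.Theory Num.Theory.
Import numFieldNormedType.Exports.
Local Open Scope classical_set_scope.
Local Open Scope ring_scope.

(* With [g_eps := max (sup G) eps], AM-GM bounds [p^p (sup X)^p] by
   [p^2 (sup X) g_eps^(p-1) + (1 - p) g_eps^p], so everything reduces to
   [E [(sup X) g_eps^(p-1)] <= p^-1 E [g_eps^p]] on each set of [F 0]. Writing
   [g^(p-1)] as an integral of indicators of [{g < c}] over the levels [c], this
   follows from [E [sup X; sup G < c] <= E [min (sup G) c]], which is the domination
   hypothesis at the first time that [G >= c], approached strictly from below.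
   Such stopping times exist since [G] is predictable: predictable sets are
   approximated from inside by zero sets of continuous adapted processes, and the
   entrance time of such a zero set is announced by those of its neighbourhoods.

   For sharpness, let [P (xi > k) = 1 / (k + 1)], let [G] grow as [(t + 1)^(1/p)]
   until the time [xi], and let [X] jump at [xi] by [p^-1 xi^(1/p)], a size bounded
   by the increments of [G] divided by the hazard rate. Up to time [n] the moments
   are [H_n + 1] and [p^-p (H_n - 1)], where [H_n] is the harmonic sum. *)

(** * Conditional expectations *)

(** A path of [G] may jump over [c], so at the first time that [G >= c] its value is not controlled
    by [c]; this is why the domination must be used strictly earlier, at the price of an event of
    small probability and of a finite horizon. No section theorem is invoked: the sets that can be
    approximated from inside, together with their complements, by zero sets of continuous adapted
    processes form a sigma-algebra that contains the generators of the predictable one. The bound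
    [eps] keeps [g_eps^(p-1)] finite where [sup G = 0]. The integral over the levels is replaced by
    a sum over the geometric levels [eps r^k], at the cost of a factor [r] that is sent to 1. The
    constant [p^-1] is [(1 - p) / p + 1], the contributions of the levels below and above [g] to
    [(1 - p) int min(g, c) c^(p-2) dc]; then [p^2 p^-1 + (1 - p) = 1], which leaves exactly [p^p] on
    the other side. Everything is done with integrals over sets of [F 0] and values in [[0, +oo]],
    so no integrability is ever assumed. *)

Section sub_sigma_algebra.
Context d (T : measurableType d) (R : realType) (H : set (set T)).
Hypothesis sH : sigma_algebra setT H.

Lemma measurable_g_sigmaE (A : set (g_sigma_algebraType H)) :
  measurable A = H A.
Proof. by rewrite /measurable/= sigma_algebra_id. Qed.

Lemma measurable_wrtP d' (S : measurableType d') (f : T -> S) :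
  measurable_wrt H f <-> forall B, measurable B -> H (f @^-1` B).
Proof.
split=> [mf B mB|mf _ B mB].
  by rewrite -measurable_g_sigmaE -[X in measurable X]setTI; exact: mf.
by rewrite setTI measurable_g_sigmaE; exact: mf.
Qed.

Hypothesis Hm : H `<=` measurable.

Lemma measurable_wrt_measurable d' (S : measurableType d') (f : T -> S) :
  measurable_wrt H f -> measurable_fun setT f.
Proof. by move=> /measurable_wrtP mf _ B mB; rewrite setTI; apply/Hm/mf. Qed.

Variable P : probability T R.
Local Open Scope ereal_scope.

Let S := g_sigma_algebraType H.

Lemma measurable_id_sub_sigma : measurable_fun [set: T] (id : T -> S).
Proof.
by move=> _ B mB; rewrite setTI; apply: Hm; rewrite -measurable_g_sigmaE.
Qed.

Section bounded.
Variable U : T -> \bar R.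
Hypothesis mU : measurable_fun setT U.
Hypothesis U0 : forall w, 0 <= U w.
Hypothesis U1 : forall w, U w <= 1.

Let Q : set S -> \bar R := fun A => P A.
Let nu : set S -> \bar R := fun A => \int[P]_(w in A) U w.

Let HmS (A : set S) : measurable A -> measurable (A : set T).
Proof. by rewrite measurable_g_sigmaE; exact: Hm. Qed.

Let Q0 : Q set0 = 0. Proof. exact: measure0. Qed.
Let Qge0 A : 0 <= Q A. Proof. exact: measure_ge0. Qed.
Let Qadd : semi_sigma_additive Q.
Proof.
move=> F mF tF mUF; apply: measure_semi_sigma_additive => //.
- by move=> i; exact: HmS.
- exact: HmS.
Qed.
HB.instance Definition _ := isMeasure.Build _ _ _ Q Q0 Qge0 Qadd.
Let Qfin : fin_num_fun Q.
Proof. by move=> A mA; rewrite fin_num_measure//; exact: HmS. Qed.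
HB.instance Definition _ := Measure_isFinite.Build _ _ _ Q Qfin.

Let nu0 : nu set0 = 0. Proof. by rewrite /nu integral_set0. Qed.
Let nuge0 A : 0 <= nu A. Proof. exact: integral_ge0. Qed.
Let nuadd : semi_sigma_additive nu.
Proof.
move=> F mF tF mUF.
have := @semi_sigma_additive_nng_induced _ T R P U mU U0 F.
apply=> //.
- by move=> i; exact: HmS.
- exact: HmS.
Qed.
HB.instance Definition _ := isMeasure.Build _ _ _ nu nu0 nuge0 nuadd.
Let nu_le A : measurable A -> nu A <= Q A.
Proof.
move=> mA; have <- : \int[P]_(w in A) cst 1 w = Q A.
  by rewrite integral_cst ?mul1e//; exact: HmS.
by apply: ge0_le_integral => //; [exact: HmS|exact: measurable_funTS].
Qed.
Let nufin : fin_num_fun nu.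
Proof.
move=> A mA; rewrite ge0_fin_numE//; apply: le_lt_trans (nu_le mA) _.
by rewrite ltey_eq fin_num_measure//; exact: HmS.
Qed.
HB.instance Definition _ := Measure_isFinite.Build _ _ _ nu nufin.

(** The density of [nu] with respect to the restriction [Q] of [P] to [H]. The bound on [U] gives
    [nu <= Q], hence both the finiteness and the absolute continuity that Radon-Nikodym asks for. *)
Lemma cond_exp_exists_bounded : exists V, is_cond_exp P H U V.
Proof.
have nuQ : nu `<< Q.
  apply/null_content_dominatesP => //= A mA QA0; apply/eqP.
  by rewrite eq_le measure_ge0 andbT -QA0 nu_le.
have [V [V0 iV VE]] := radon_nikodym_finite nuQ.
have mV : measurable_fun [set: S] V by exact: measurable_int iV.
exists V; split => // A HA.
have mA : measurable (A : set S) by rewrite measurable_g_sigmaE.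
transitivity (nu A) => //; rewrite VE//.
(* [Q] is by computation the pushforward of [P] along the identity from [T] to [S]; the change of
   variables moves the integral between the two sigma-algebras. *)
transitivity (\int[pushforward P (id : T -> S)]_(y in A) V y).
  rewrite ge0_integral_pushforward//; first exact: measurable_id_sub_sigma.
  exact: measurable_funTS.
by [].
Qed.

End bounded.

Lemma cond_exp_exists (U : T -> \bar R) : measurable_fun setT U ->
  (forall w, 0 <= U w) -> exists V, is_cond_exp P H U V.
Proof.
move=> mU U0.
(* [U] is not assumed integrable: it is cut into slices bounded by 1. *)
pose D (n : nat) (w : T) : \bar R := mine (U w) n.+1%:R%:E - mine (U w) n%:R%:E.
have D0 n w : 0 <= D n w.
  rewrite /D; case: (U w) (U0 w) => [u||]//.
    rewrite lee_fin -!EFin_min -EFinB lee_fin subr_ge0 => u0.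
    rewrite le_min !ge_min lexx /=.
    by rewrite ler_nat leqnSn orbT.
  by rewrite !minye -EFinB lee_fin subr_ge0 ler_nat.
have D1 n w : D n w <= 1.
  rewrite /D; case: (U w) (U0 w) => [u||]//.
    rewrite lee_fin -!EFin_min -EFinB lee_fin => u0.
    have -> : (n.+1%:R = n%:R + 1 :> R)%R by rewrite -natr1.
    by rewrite /Order.min; do 2 case: ifPn; rewrite -?leNgt; lra.
  by rewrite !minye -EFinB lee_fin -natrB// subSnn.
have mD n : measurable_fun setT (D n).
  by apply: emeasurable_funB; apply: measurable_mine.
have DU w : \sum_(n <oo) D n w = U w.
  apply: cvg_lim => //.
  have -> : (fun n => \sum_(0 <= i < n) D i w) = fun n => mine (U w) n%:R%:E.
    apply/funext; elim => [|n IH].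
      rewrite big_geq//; case: (U w) (U0 w) => [u||]//.
        by rewrite lee_fin -EFin_min => u0; rewrite min_r.
    rewrite big_nat_recr//= IH -[LHS]/(mine (U w) n%:R%:E + D n w) /D.
    rewrite addeC subeK//.
    case: (U w) (U0 w) => [u||]//; by rewrite -EFin_min.
  case: (U w) (U0 w) => [u||]// u0.
    apply: (@cvg_near_cst _ _ _ _ _ _); near=> n.
    rewrite -EFin_min min_l//.
    near: n; exact: nbhs_infty_ger.
  under eq_fun do rewrite minye.
  exact/cvgenyP.
have /choice[V VP] n := cond_exp_exists_bounded (mD n) (D0 n) (D1 n).
exists (fun w => \sum_(n <oo) V n w); split.
- apply: ge0_emeasurable_sum.
    by move=> k w _ _; case: (VP k).
  by move=> k _; case: (VP k).
- by move=> w; apply: nneseries_ge0 => k _ _; case: (VP k).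
- move=> A HA; rewrite integral_nneseries; last 3 first.
  + exact: Hm.
  + move=> n; apply: measurable_funTS; apply: measurable_wrt_measurable.
    by case: (VP n).
  + by move=> n w _; case: (VP n).
  under eq_eseriesr => n _.
    have [_ _ ->//] := VP n.
  over.
  rewrite -integral_nneseries//; last 2 first.
  + exact: Hm.
  + by move=> n; apply: measurable_funTS.
  by apply: eq_integral => w _.
Unshelve. all: by end_near. Qed.

Lemma cond_expP (U : T -> \bar R) : measurable_fun setT U ->
  (forall w, 0 <= U w) -> is_cond_exp P H U (cond_exp P H U).
Proof. by move=> mU /(cond_exp_exists mU)[V VP]; exact: (xgetPex _ (ex_intro _ V VP)). Qed.

(** The set where [W < V] is covered by the sets [D n]. On each of them the bound on [W] makes its
    integral finite, so that it can be cancelled, and the gap [1/(n+1)] forces measure 0. *)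
Lemma le_ae_of_integral (V W : T -> \bar R) :
  measurable_wrt H V -> measurable_wrt H W ->
  (forall w, 0 <= V w) -> (forall w, 0 <= W w) ->
  (forall A, H A -> \int[P]_(w in A) V w <= \int[P]_(w in A) W w) ->
  \forall w \ae P, V w <= W w.
Proof.
move=> HV HW V0 W0 VW.
have mV := measurable_wrt_measurable HV.
have mW := measurable_wrt_measurable HW.
pose D (n : nat) := [set w | W w <= n%:R%:E] `&` [set w | W w + n.+1%:R^-1%:E <= V w].
have HD n : H (D n).
  rewrite -measurable_g_sigmaE; apply: measurableI.
    rewrite -[X in measurable X]setTI.
    exact: (@measurable_lee _ S R setT measurableT W (cst n%:R%:E)).
  rewrite -[X in measurable X]setTI.
  by apply: (@measurable_lee _ S R setT measurableT) => //; exact: emeasurable_funD.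
have D_null n : P (D n) = 0.
  have mD := Hm (HD n).
  have Wfin : \int[P]_(w in D n) W w \is a fin_num.
    rewrite ge0_fin_numE; last exact: integral_ge0.
    apply: (@le_lt_trans _ _ (n%:R%:E * P (D n))).
      rewrite -integral_cst//; apply: ge0_le_integral => //.
      - exact: measurable_funTS.
      - by move=> w [].
    by rewrite ltey_eq fin_numM// fin_num_measure.
  have : \int[P]_(w in D n) W w + n.+1%:R^-1%:E * P (D n) <= \int[P]_(w in D n) W w.
    apply: le_trans (VW _ (HD n)); rewrite -integral_cst// -ge0_integralD//; last 2 first.
      exact: measurable_funTS.
      by move=> w _; rewrite lee_fin.
    apply: ge0_le_integral => //.
    - by move=> w _; apply: adde_ge0 => //; rewrite lee_fin.
    - by apply: emeasurable_funD => //; exact: measurable_funTS.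
    - exact: measurable_funTS.
    - by move=> w [].
  rewrite -[leRHS]adde0 leeD2lE// => h.
  apply/eqP; rewrite eq_le measure_ge0 andbT.
  by rewrite -(@pmule_rle0 _ n.+1%:R^-1%:E)// lte_fin.
suff : P.-negligible (\bigcup_n D n).
  apply: negligibleS => w /= /negP; rewrite -ltNge => WV.
  have Wr : W w \is a fin_num by rewrite ge0_fin_numE// (lt_le_trans WV)// leey.
  move: Wr WV (W0 w); rewrite /D.
  case EW : (W w) => [r| |]// _ WV r0.
  suff [n [n1 n2]] : exists n : nat, r%:E <= n%:R%:E /\ r%:E + n.+1%:R^-1%:E <= V w.
    by exists n => //; split; rewrite /= EW.
  have [k rk] : exists k : nat, (r <= k%:R)%R.
    by exists (Num.truncn r).+1; apply/ltW/truncnS_gt.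
  have [m rm] : exists m : nat, r%:E + m.+1%:R^-1%:E <= V w.
    case: (V w) WV => [v| |]//; last by exists 0%N; rewrite leey.
    rewrite lte_fin => rv.
    have vr : (0 < v - r)%R by rewrite subr_gt0.
    exists (Num.truncn (v - r)^-1); rewrite -EFinD lee_fin -lerBrDl.
    rewrite -[leRHS]invrK lef_pV2 ?posrE ?invr_gt0//.
    exact/ltW/truncnS_gt.
  exists (maxn k m); split; first by rewrite lee_fin (le_trans rk)// ler_nat leq_maxl.
  apply: le_trans rm; rewrite leeD2l// lee_fin lef_pV2 ?posrE//.
  by rewrite ler_nat ltnS leq_maxr.
apply: negligible_bigcup => n; apply/negligibleP; last exact: D_null.
exact: Hm (HD n).
Qed.

(** The bridge from integrals over the sets of [H] to conditional expectations, crossed the other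
    way by [integral_le_of_cond_exp]. Only nonnegativity is asked for, so infinite conditional
    expectations are covered. *)
Lemma cond_exp_le_ae (U W : T -> \bar R) (c : R) : (0 <= c)%R ->
  measurable_fun setT U -> measurable_fun setT W ->
  (forall w, 0 <= U w) -> (forall w, 0 <= W w) ->
  (forall A, H A -> \int[P]_(w in A) U w <= c%:E * \int[P]_(w in A) W w) ->
  \forall w \ae P, cond_exp P H U w <= c%:E * cond_exp P H W w.
Proof.
move=> c0 mU mW U0 W0 UW.
have [HVU VU0 VUE] := cond_expP mU U0; have [HVW VW0 VWE] := cond_expP mW W0.
apply: le_ae_of_integral => //.
- exact: measurable_funeM.
- by move=> w; rewrite mule_ge0.
move=> A HA; rewrite VUE// ge0_integralZl_EFin//; last 2 first.
- exact: Hm.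
- by apply: measurable_funTS; exact: measurable_wrt_measurable.
by rewrite VWE// UW.
Qed.

Lemma integral_le_of_cond_exp (U W : T -> \bar R) (c : R) : (0 <= c)%R ->
  measurable_fun setT U -> measurable_fun setT W ->
  (forall w, 0 <= U w) -> (forall w, 0 <= W w) ->
  (\forall w \ae P, cond_exp P H U w <= c%:E * cond_exp P H W w) ->
  forall A, H A -> \int[P]_(w in A) U w <= c%:E * \int[P]_(w in A) W w.
Proof.
move=> c0 mU mW U0 W0 UW A HA.
have [HVU VU0 VUE] := cond_expP mU U0; have [HVW VW0 VWE] := cond_expP mW W0.
have mVW := measurable_wrt_measurable HVW.
rewrite -VUE// -VWE// -ge0_integralZl_EFin//; last 2 first.
- exact: Hm.
- exact: measurable_funTS.
apply: ae_ge0_le_integral => //.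
- exact: Hm.
- by apply: measurable_funTS; exact: measurable_wrt_measurable.
- by move=> w _; rewrite mule_ge0.
- by apply: measurable_funTS; exact: measurable_funeM.
- by apply: filterS UW => w + _.
Qed.

End sub_sigma_algebra.

(** * Processes at random times *)

Section glue.
Context d (S : measurableType d) (R : realType).

Lemma measurable_fun_glue (f : S -> nat) (Y : nat -> S -> R) :
  (forall k, measurable [set z | f z = k]) ->
  (forall k, measurable_fun setT (Y k)) ->
  measurable_fun setT (fun z => Y (f z) z).
Proof.
move=> mf mY _ B mB; rewrite setTI.
rewrite (_ : _ @^-1` _ = \bigcup_k ([set z | f z = k] `&` Y k @^-1` B)).
  apply: bigcupT_measurable => k; apply: measurableI => //.
  by rewrite -[X in measurable X]setTI; exact: mY.
by apply/seteqP; split => [z /= Bz|z [k _ [/= ->]]//]; exists (f z).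
Qed.

End glue.

Section level_sets.
Context d (S : measurableType d) (R : realType) (f : S -> R).
Hypothesis mf : measurable_fun setT f.

Lemma measurable_sublevel_lt c : measurable [set z | f z < c].
Proof.
rewrite (_ : [set _ | _] = [set: S] `&` f @^-1` `]-oo, c[); first exact: mf.
by rewrite setTI; apply/seteqP; split => z /=; rewrite in_itv.
Qed.

Lemma measurable_sublevel_le c : measurable [set z | f z <= c].
Proof.
rewrite (_ : [set _ | _] = [set: S] `&` f @^-1` `]-oo, c]); first exact: mf.
by rewrite setTI; apply/seteqP; split => z /=; rewrite in_itv.
Qed.

Lemma measurable_superlevel_ge c : measurable [set z | c <= f z].
Proof.
rewrite (_ : [set _ | _] = ~` [set z | f z < c]).
  exact/measurableC/measurable_sublevel_lt.
by apply/seteqP; split => z /=; rewrite leNgt => /negP.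
Qed.

Lemma measurable_neq0 : measurable [set z | f z != 0].
Proof.
rewrite (_ : [set _ | _] = ~` ([set z | f z <= 0] `&` [set z | 0 <= f z])).
  apply/measurableC/measurableI; first exact: measurable_sublevel_le.
  exact: measurable_superlevel_ge.
apply/seteqP; split => z /=; rewrite eq_le => fz; first by apply/andP.
by apply/negP => /andP.
Qed.

End level_sets.

Section vanishing.
Context d (T : measurableType d) (R : realType) (P : probability T R).

Lemma nonincreasing_le_measure (E : (set T)^nat) (e : R) :
  (forall n, measurable (E n)) -> nonincreasing_seq E ->
  (P (\bigcap_n E n) < e%:E)%E -> exists n, (P (E n) <= e%:E)%E.
Proof.
move=> mE niE PE.
have fE n : P (E n) \is a fin_num by rewrite fin_num_measure.
have mI : measurable (\bigcap_n E n) by exact: bigcap_measurableType.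
have P0 : (P (E 0%N) < +oo)%E by rewrite ltey_eq fE.
have cE := nonincreasing_cvg_mu P0 mE mI niE.
 apply: contrapT => /forallNP nE; move: PE; apply/negP; rewrite -leNgt.
apply: (@cvge_ge _ _ _ _ _ _ _ _ cE).
by apply: nearW => n; apply/ltW; rewrite ltNge; apply/negP/nE.
Qed.

End vanishing.

Section processes.
Context d (T : measurableType d) (R : realType).
Implicit Types (X : R -> T -> R) (tau : T -> R).

(** [tau] is approximated strictly from above by times valued in the multiples of [1/(n+1)], at
    which [X] is glued from countably many measurable functions; right continuity gives the
    limit. *)
Lemma measurable_at_random_time X tau : right_continuous X ->
  (forall t, 0 <= t -> measurable_fun setT (X t)) ->
  measurable_fun setT tau -> (forall w, 0 <= tau w) ->
  measurable_fun setT (fun w => X (tau w) w).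
Proof.
move=> rcX mX mtau tau0.
pose f n w := Num.truncn (n.+1%:R * tau w).
pose q (n k : nat) : R := k.+1%:R / n.+1%:R.
have f_itv n w : (f n w)%:R <= n.+1%:R * tau w < (f n w).+1%:R.
  by apply: truncn_itv; rewrite mulr_ge0.
have q_gt n w : tau w < q n (f n w).
  by rewrite ltr_pdivlMr// mulrC; case/andP: (f_itv n w).
have q_le n w : q n (f n w) <= tau w + n.+1%:R^-1.
  rewrite ler_pdivrMr// mulrDl mulVf// mulrC -natr1 lerD2r.
  by case/andP: (f_itv n w).
apply: (@measurable_fun_cvg _ _ _ _ (fun n w => X (q n (f n w)) w)).
  move=> n; apply: (@measurable_fun_glue _ _ _ (f n) (fun k => X (q n k))).
    move=> k; rewrite (_ : [set _ | _] =
        [set w | k%:R / n.+1%:R <= tau w] `&` [set w | tau w < k.+1%:R / n.+1%:R]).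
      apply: measurableI; first exact: measurable_superlevel_ge.
      exact: measurable_sublevel_lt.
    apply/seteqP; split=> w /=.
      by move=> <-; rewrite ler_pdivrMr// ltr_pdivlMr// mulrC; apply/andP/f_itv.
    rewrite ler_pdivrMr// ltr_pdivlMr// mulrC => /andP; exact: truncn_def.
  by move=> k; apply: mX; rewrite divr_ge0.
move=> w _.
have /cvg_at_rightP := rcX (tau w) w (tau0 w); apply; split => //.
apply: (@squeeze_cvgr _ _ _ _ (fun=> tau w) (fun n => tau w + n.+1%:R^-1)).
- by near=> n; rewrite q_le ltW.
- exact: cvg_cst.
- rewrite -[X in _ --> X]addr0; apply: cvgD; first exact: cvg_cst.
  exact: cvg_harmonic.
Unshelve. all: by end_near. Qed.

Lemma cvg_sup_process X w : Defs.nondecreasing X ->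
  (X n%:R w)%:E @[n --> \oo] --> sup_process X w.
Proof.
move=> ndX.
have -> : sup_process X w = ereal_sup (range (fun n : nat => (X n%:R w)%:E)).
  apply/eqP; rewrite eq_le; apply/andP; split; apply: ge_ereal_sup.
    move=> _ [t] /[swap] <- /=; rewrite in_itv/= andbT => t0.
    have [n tn] : exists n : nat, t <= n%:R.
      by exists (Num.truncn t).+1; apply/ltW/truncnS_gt.
    apply: (@le_trans _ _ (X n%:R w)%:E); first by rewrite lee_fin; exact: (ndX _ _ _ t0 tn).
    by apply: ereal_sup_ubound; exists n.
  move=> _ [n _ <-]; apply: ereal_sup_ubound; exists n%:R => //=.
  by rewrite in_itv/= ler0n.
by apply: ereal_nondecreasing_cvgn => m n mn; rewrite lee_fin ndX// ler_nat.
Qed.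

Lemma le_sup_process X t w : 0 <= t -> ((X t w)%:E <= sup_process X w)%E.
Proof.
by move=> t0; apply: ereal_sup_ubound; exists t => //=; rewrite in_itv/= t0.
Qed.

Lemma sup_process_ge0 X w : nonnegative X -> (0 <= sup_process X w)%E.
Proof.
by move=> X0; apply: le_trans (le_sup_process X w (lexx 0)); rewrite lee_fin X0.
Qed.

Lemma measurable_sup_process X : Defs.nondecreasing X ->
  (forall t, 0 <= t -> measurable_fun setT (X t)) ->
  measurable_fun setT (sup_process X).
Proof.
move=> ndX mX; apply: (emeasurable_fun_cvg (fun n w => (X n%:R w)%:E)).
  by move=> n; apply/measurable_EFinP; exact: mX.
by move=> w _; exact: cvg_sup_process.
Qed.

Lemma measurable_sup_power p X : Defs.nondecreasing X ->
  (forall t, 0 <= t -> measurable_fun setT (X t)) ->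
  measurable_fun setT (sup_power p X).
Proof.
move=> ndX mX; apply: (measurableT_comp (measurable_poweR p)).
exact: measurable_sup_process.
Qed.

End processes.

Lemma measurable_of_sublevels d (T : measurableType d) (R : realType)
    (tau : T -> R) : (forall w, 0 <= tau w) ->
  (forall t, 0 <= t -> measurable [set w | tau w <= t]) ->
  measurable_fun setT tau.
Proof.
move=> tau0 mtau; apply: (measurability _ (RGenOInfty.measurableE R)) => //.
move=> _ [_ [t ->] <-]; rewrite setTI.
rewrite (_ : _ @^-1` _ = ~` [set w | tau w <= t]); last first.
  by apply/seteqP; split => w /=; rewrite in_itv/= andbT ltNge => /negP.
apply: measurableC; have [t0|t0] := leP 0 t; first exact: mtau.
rewrite (_ : [set _ | _] = set0)//; apply/seteqP; split => // w /=.
by rewrite leNgt (lt_le_trans t0).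
Qed.

Section usual_filtrations.
Context d (T : measurableType d) (R : realType) (P : probability T R).
Context (F : R -> set (set T)).
Hypothesis uF : usual_conditions P F.

Let fF : filtration F. Proof. by case: uF. Qed.

Lemma adapted_measurable X : adapted F X ->
  forall t, 0 <= t -> measurable_fun setT (X t).
Proof.
case: fF => sF Fm _ aX t t0.
exact: measurable_wrt_measurable (sF t t0) (Fm t t0) _ _ _ (aX t t0).
Qed.

Lemma measurable_stopping_time tau : bounded_stopping_time F tau ->
  measurable_fun setT tau.
Proof.
case: fF => _ Fm _ [tau0 tauF _]; apply: measurable_of_sublevels => // t t0.
exact: Fm t t0 _ (tauF t t0).
Qed.

Lemma domination_integral X G : dominated_pair P F X G ->
  forall tau, bounded_stopping_time F tau -> forall A, F 0 A ->
  (\int[P]_(w in A) at_time X tau w <= \int[P]_(w in A) at_time G tau w)%E.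
Proof.
move=> [ndX X0 aX rX ndG G0 aG rG pG dom] tau tauS A FA.
have tau0 : forall w, 0 <= tau w by case: tauS.
have mtau := measurable_stopping_time tauS.
case: fF => sF Fm _.
rewrite -[leRHS]mul1e; apply: (integral_le_of_cond_exp (sF 0 (lexx 0)) (Fm 0 (lexx 0))) => //.
- apply/measurable_EFinP; apply: measurable_at_random_time => //.
  exact: adapted_measurable.
- apply/measurable_EFinP; apply: measurable_at_random_time => //.
  exact: adapted_measurable.
- by move=> w; rewrite lee_fin X0.
- by move=> w; rewrite lee_fin G0.
by apply: filterS (dom _ tauS) => w; rewrite mul1e.
Qed.

End usual_filtrations.

(** * Inner regularity of predictable sets *)

Section test_processes.
Context d (T : measurableType d) (R : realType) (F : R -> set (set T)).

(* Defined and continuous on all of [R], so that no boundary case arises at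
   time 0. *)
Record test_process (Y : R -> T -> R) : Prop := TestProcess {
  test_ge0 : forall t w, 0 <= Y t w;
  test_continuous : forall w, continuous (Y ^~ w);
  test_adapted : adapted F Y }.

Lemma test_cst (c : R) : 0 <= c -> test_process (fun _ _ => c).
Proof.
move=> c0; split => // [w|t t0]; first exact: cst_continuous.
exact: measurable_cst.
Qed.

Lemma test_min (Y Z : R -> T -> R) : test_process Y -> test_process Z ->
  test_process (fun t w => Num.min (Y t w) (Z t w)).
Proof.
move=> [Y0 cY aY] [Z0 cZ aZ]; split => [t w|w t|t t0].
- by rewrite le_min Y0 Z0.
- by apply: continuous_min; [exact: cY|exact: cZ].
- by apply: measurable_minr; [exact: aY|exact: aZ].
Qed.

Lemma test_truncated_sub (c : R) (Y : R -> T -> R) : test_process Y ->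
  test_process (fun t w => Num.max 0 (c - Y t w)).
Proof.
move=> [Y0 cY aY]; split => [t w|w t|t t0].
- by rewrite le_max lexx.
- apply: (@continuous_max _ _ (cst 0) (fun s => c - Y s w)).
    exact: cst_continuous.
  by apply: continuousB; [exact: cst_continuous|exact: cY].
- apply: measurable_maxr; first exact: measurable_cst.
  by apply: measurable_funB; [exact: measurable_cst|exact: aY].
Qed.

(** Countable intersections of zero sets are zero sets. Capping the [i]-th process at [1/(i+1)]
    keeps its zeros and makes all but finitely many processes uniformly small, so that continuity
    survives the supremum. *)
Lemma sup_test (Y : nat -> R -> T -> R) : (forall i, test_process (Y i)) ->
  exists2 Z, test_process Z &
    forall t w, Z t w = 0 <-> forall i, Y i t w = 0.
Proof.
move=> tY.
pose f i t w : R := Num.min (Y i t w) i.+1%:R^-1.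
have f0 i t w : 0 <= f i t w by rewrite le_min (test_ge0 (tY i)) invr_ge0/=.
have fi i t w : f i t w <= i.+1%:R^-1 by rewrite ge_min lexx orbT.
have f1 i t w : f i t w <= 1 by apply: le_trans (fi _ _ _) _; rewrite invf_le1// ler1n.
pose Z t w := sup (range (fun i => f i t w)).
have ubf t w : has_ubound (range (fun i => f i t w)) by exists 1 => _ [i _ <-].
have fZ i t w : f i t w <= Z t w.
  by apply: ub_le_sup => //; exists i.
have Zle t w c : (forall i, f i t w <= c) -> Z t w <= c.
  move=> fc; apply: ge_sup; first by exists (f 0%N t w), 0%N.
  by move=> _ [i _ <-].
exists Z; first split.
- by move=> t w; exact: le_trans (f0 0%N t w) (fZ _ _ _).
- move=> w t; apply/cvgrPdist_le => e e0.
  have [n ne] : exists n : nat, n.+1%:R^-1 <= e.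
    exists (Num.truncn e^-1); rewrite -[leRHS]invrK lef_pV2 ?posrE ?invr_gt0//.
    exact/ltW/truncnS_gt.
  have fnear : \forall s \near t, forall i, (i < n)%N -> `|f i t w - f i s w| <= e.
    elim: n {ne} => [|n IH]; first by near=> s.
    have cf : {for t, continuous (fun s => f n s w)}.
      apply: continuous_min; first exact: (test_continuous (tY n)).
      exact: cst_continuous.
    move/cvgrPdist_le : cf => /(_ _ e0) cf.
    near=> s => i; rewrite ltnS leq_eqVlt => /orP[/eqP->|].
      by near: s.
    by move: i; near: s.
  near=> s.
  have fts : forall i, (i < n)%N -> `|f i t w - f i s w| <= e by near: s.
  rewrite ler_distl; apply/andP; split.
    rewrite lerBlDr; apply: Zle => i; have [ilt|ige] := ltnP i n.
      have := fts _ ilt; rewrite ler_distl => /andP[+ _].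
      by rewrite lerBlDr => /le_trans; apply; rewrite lerD2r.
    apply: le_trans (fi _ _ _) _; apply: (@le_trans _ _ e).
      by apply: le_trans ne; rewrite lef_pV2 ?posrE// ler_nat.
    by rewrite lerDr (le_trans (f0 0%N t w)).
  apply: Zle => i; have [ilt|ige] := ltnP i n.
    have := fts _ ilt; rewrite ler_distl => /andP[_ +].
    by move=> /le_trans; apply; rewrite lerD2r.
  apply: le_trans (fi _ _ _) _; apply: (@le_trans _ _ e).
    by apply: le_trans ne; rewrite lef_pV2 ?posrE// ler_nat.
  by rewrite lerDr (le_trans (f0 0%N s w)).
- move=> t t0; rewrite (_ : Z t = fun w => sups (fun i => f i t w) 0%N); last first.
    apply/funext => w; rewrite /Z /sups; congr sup.
    by apply/seteqP; split => x [i _ <-]; exists i.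
  apply: measurable_fun_sups => //= i.
  apply: measurable_minr; first exact: (test_adapted (tY i)).
  exact: measurable_cst.
- move=> t w; split => [Z0 i|Y0].
    apply/eqP; rewrite eq_le (test_ge0 (tY i)) andbT leNgt; apply/negP => Yi.
    have := fZ i t w; rewrite Z0 leNgt => /negP; apply.
    by rewrite lt_min Yi invr_gt0/=.
  apply/eqP; rewrite eq_le (le_trans (f0 0%N t w))// andbT.
  by apply: Zle => i; rewrite /f Y0 ge_min lexx.
Unshelve. all: by end_near. Qed.

End test_processes.

Section regularity.
Context d (T : measurableType d) (R : realType) (P : probability T R).
Context (F : R -> set (set T)).
Hypothesis fF : filtration F.
Variable tau : T -> R.
Hypothesis mtau : measurable_fun setT tau.
Hypothesis tau0 : forall w, 0 <= tau w.

(* Inner regularity of the law of [(tau w, w)], with the zero sets of test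
   processes in the role of the compact sets. *)
Definition regular_along (S : set (R * T)) : Prop := forall e : R, 0 < e ->
  exists Y Z, [/\ test_process F Y, test_process F Z,
    forall t w, 0 <= t -> Y t w = 0 -> S (t, w),
    forall t w, 0 <= t -> Z t w = 0 -> ~ S (t, w) &
    (P [set w | (Y (tau w) w != 0)%R /\ (Z (tau w) w != 0)%R] <= e%:E)%E].

Lemma measurable_test_neq0 (Y : R -> T -> R) : test_process F Y ->
  measurable [set w | Y (tau w) w != 0].
Proof.
move=> [Y0 cY aY]; case: fF => sF Fm _.
apply: measurable_neq0; apply: measurable_at_random_time => //.
  by move=> t w _; apply: cvg_at_right_filter; exact: cY.
by move=> t t0; exact: measurable_wrt_measurable (sF t t0) (Fm t t0) _ _ _ (aY t t0).
Qed.

Lemma regularC S : regular_along S -> regular_along (~` S).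
Proof.
move=> rS e /rS[Y [Z [tY tZ YS ZS PYZ]]]; exists Z, Y; split => //.
- by move=> t w t0 /(YS _ _ t0) St; apply.
- by under eq_set do rewrite andC.
Qed.

Lemma eq_regular S S' : (forall t w, 0 <= t -> S (t, w) <-> S' (t, w)) ->
  regular_along S -> regular_along S'.
Proof.
move=> SS' rS e /rS[Y [Z [tY tZ YS ZS PYZ]]]; exists Y, Z; split => //.
- by move=> t w t0 /(YS _ _ t0) St; apply/SS'.
- by move=> t w t0 /(ZS _ _ t0) St /(SS' _ _ t0).
Qed.

Lemma regular0 : regular_along set0.
Proof.
move=> e e0; exists (fun _ _ => 1), (fun _ _ => 0); split.
- exact: test_cst.
- exact: test_cst.
- by move=> t w _ /eqP; rewrite oner_eq0.
- by move=> t w _ _ [].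
- rewrite (_ : [set _ | _] = set0) ?measure0 ?lee_fin ?ltW//.
  by apply/seteqP; split => w //= [_]; rewrite eqxx.
Qed.

(** The set where [Z] does not vanish is the increasing union of the sets [{Z >= 1/(n+1)}], which
    are the zero sets of the [Y n]; continuity from above picks one that loses at most [e]. The
    complement is the zero set of [Z] itself. *)
Lemma regular_neq0 Z : test_process F Z ->
  regular_along [set z | Z z.1 z.2 != 0].
Proof.
move=> tZ e e0.
pose Y (n : nat) t w := Num.max 0 (n.+1%:R^-1 - Z t w).
have tY n : test_process F (Y n) by exact: test_truncated_sub.
pose E n := [set w | Y n (tau w) w != 0] `&` [set w | Z (tau w) w != 0].
have Y_eq0 n t w : (Y n t w == 0) = (n.+1%:R^-1 <= Z t w).
  by rewrite /Y eq_maxl subr_le0.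
have [n En] : exists n, (P (E n) <= e%:E)%E.
  apply: nonincreasing_le_measure.
  - by move=> n; apply: measurableI; exact: measurable_test_neq0.
  - move=> m n mn; apply/subsetPset => w [/=]; rewrite !Y_eq0 => Yn Z0; split => //=.
    rewrite Y_eq0; apply: contra Yn; apply: le_trans.
    by rewrite lef_pV2 ?posrE// ler_nat.
  rewrite (_ : \bigcap_n E n = set0) ?measure0 ?lte_fin//.
  apply/seteqP; split => // w Ew; have [_ /= Z0] := Ew 0%N I.
  have {}Z0 : 0 < Z (tau w) w by rewrite lt0r Z0 (test_ge0 tZ).
  have [/= + _] := Ew (Num.truncn (Z (tau w) w)^-1) I; rewrite Y_eq0 => /negP; apply.
  rewrite -[leRHS]invrK lef_pV2 ?posrE ?invr_gt0//.
  exact/ltW/truncnS_gt.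
exists (Y n), Z; split => //.
- move=> t w _ /eqP; rewrite Y_eq0 => /= Zt; rewrite gt_eqF//.
  by apply: lt_le_trans Zt; rewrite invr_gt0.
- by move=> t w _ /= ->; rewrite eqxx.
Qed.

(** Outside the union, [sup_test] merges all the zero sets into one. Inside, only finitely many can
    be joined, by a minimum, since an infinite infimum may vanish where none of its terms does;
    continuity from above chooses how many. *)
Lemma regular_bigcup (S : nat -> set (R * T)) :
  (forall i, regular_along (S i)) -> regular_along (\bigcup_i S i).
Proof.
move=> rS e e0.
(* These errors add up to [e / 2], which leaves room for the strict inequality in
   [nonincreasing_le_measure]. *)
have e2 i : 0 < e / (2 ^ i.+2)%:R by rewrite divr_gt0// ltr0n expn_gt0.
have /choice[Y /choice[Z YZ]] i := rS i _ (e2 i).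
have tY i : test_process F (Y i) by case: (YZ i).
have tZ i : test_process F (Z i) by case: (YZ i).
have [Zs tZs Zs0] := sup_test tZ.
pose Yn := fix Yn n : R -> T -> R := if n is m.+1
  then fun t w => Num.min (Yn m t w) (Y m t w) else fun _ _ => 1.
have tYn n : test_process F (Yn n).
  by elim: n => [|n IH]; [exact: test_cst|exact: test_min].
have Yn0 n t w : Yn n t w != 0 <-> forall i, (i < n)%N -> Y i t w != 0.
  elim: n => [|n IH]; first by split => // _; exact: oner_neq0.
  have Yn0 := test_ge0 (tYn n) t w; have Y0 := test_ge0 (tY n) t w.
  rewrite [Yn n.+1 t w]/= neq_lt [X in X || _]ltNge le_min Yn0 Y0 /= lt_min.
  rewrite !lt0r Yn0 Y0 !andbT; split.
    move=> /andP[/IH Yi Yn1] i; rewrite ltnS leq_eqVlt => /orP[/eqP->//|]; exact: Yi.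
  move=> Yi; apply/andP; split; last exact: Yi.
  by apply/IH => i ni; apply: Yi; rewrite ltnS ltnW.
pose E n := [set w | Yn n (tau w) w != 0] `&` [set w | Zs (tau w) w != 0].
have mE n : measurable (E n) by apply: measurableI; exact: measurable_test_neq0.
pose B i := [set w | Y i (tau w) w != 0] `&` [set w | Z i (tau w) w != 0].
have mB i : measurable (B i) by apply: measurableI; exact: measurable_test_neq0.
have [n En] : exists n, (P (E n) <= e%:E)%E.
  apply: nonincreasing_le_measure => //.
    move=> m n mn; apply/subsetPset => w [/= /Yn0 Yi Z0]; split => //=.
    by apply/Yn0 => i im; apply: Yi; exact: leq_trans mn.
  apply: (@le_lt_trans _ _ (P (\bigcup_i B i))).
    apply: le_measure; rewrite ?inE; [exact: bigcap_measurableType|exact: bigcupT_measurable|].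
    move=> w Ew; have [_ /= Zs_neq0] := Ew 0%N I.
    have [i Zi] : exists i, Z i (tau w) w != 0.
      apply: contrapT => /forallNP Zi; move: Zs_neq0; apply/negP/negPn/eqP/Zs0 => i.
      by apply/eqP/negPn/negP/Zi.
    exists i => //; split => //=; have [h _] := Ew i.+1 I.
    exact: ((Yn0 i.+1 _ _).1 h i (ltnSn i)).
  apply: (@le_lt_trans _ _ (\sum_(i <oo) P (B i))%E).
    by apply: measure_sigma_subadditive => //; exact: bigcupT_measurable.
  apply: (@le_lt_trans _ _ (\sum_(i <oo) (e / 2 / (2 ^ i.+1)%:R)%:E)%E).
    apply: lee_nneseries => // i _; have [_ _ _ _ +] := YZ i.
    move=> /le_trans; apply; rewrite lee_fin expnS natrM invfM mulrA.
    by [].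
  by apply: (le_lt_trans (epsilon_trick0 _ _)); rewrite ?lte_fin; lra.
exists (Yn n), Zs; split => //.
- move=> t w t0 /eqP Y0.
  have [i [_ Yi]] : exists i, (i < n)%N /\ Y i t w = 0.
    apply: contrapT => /forallNP Yi; move: Y0; apply/negP/Yn0 => i ni.
    by apply/eqP => Yi0; apply: (Yi i).
  by exists i => //; have [_ _ + _ _] := YZ i; apply.
- move=> t w t0 /Zs0 Z0 [i _]; have [_ _ _ + _] := YZ i; exact.
Qed.

Lemma sigma_algebra_regular : sigma_algebra setT regular_along.
Proof.
split; [exact: regular0| |exact: regular_bigcup].
by move=> A rA; rewrite setTD; exact: regularC.
Qed.

Lemma regularI S S' : regular_along S -> regular_along S' ->
  regular_along (S `&` S').
Proof.
move=> rS rS'.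
rewrite -[S `&` S']setCK setCI; apply: regularC.
rewrite -bigcup2E; apply: regular_bigcup => i.
rewrite /bigcup2; case: ifP => _; first exact: regularC.
by case: ifP => _; [exact: regularC|exact: regular0].
Qed.

(** This set is where [(t - s)^+ 1_A] does not vanish. The process is adapted because its first
    factor is 0 as long as [A] need not belong to [F t]. *)
Lemma regular_after s A : 0 <= s -> F s A ->
  regular_along [set z | s < z.1 /\ A z.2].
Proof.
move=> s0 FA; pose Z (t : R) w := Num.max 0 (t - s) * \1_A w.
apply: (@eq_regular [set z | Z z.1 z.2 != 0]).
  move=> t w t0; rewrite /= /Z mulf_eq0 negb_or indicE; split.
    move=> /andP[ts]; rewrite pnatr_eq0 eqb0 negbK inE => Aw; split => //.
    by rewrite ltNge; apply: contra ts => ts; rewrite eq_maxl subr_le0.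
  move=> [st Aw]; rewrite mem_set//= oner_eq0 andbT gt_eqF// lt_max subr_gt0.
  by rewrite st orbT.
apply: regular_neq0; split => [t w|w|t t0].
- by rewrite mulr_ge0// le_max lexx.
- move=> t; apply: cvgM; last exact: cvg_cst.
  apply: (@continuous_max _ _ (cst 0) (fun t => t - s)); first exact: cst_continuous.
  by apply: continuousB; [exact: cvg_id|exact: cst_continuous].
- rewrite /Z; have [ts|st] := leP (t - s) 0.
    rewrite (_ : (fun w => _) = fun=> 0); first exact: measurable_cst.
    by apply/funext => w; rewrite mul0r.
  apply: measurable_funM; first exact: measurable_cst.
  apply: measurable_indic; case: fF => sF _ Fle.
  rewrite (measurable_g_sigmaE (sF t t0)).
  by apply: (Fle s) => //; rewrite subr_gt0 in st; exact: ltW.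
Qed.

Lemma regular_const A : F 0 A -> regular_along [set z | A z.2].
Proof.
move=> FA; pose Z (t : R) w : R := \1_A w.
apply: (@eq_regular [set z | Z z.1 z.2 != 0]).
  move=> t w t0; rewrite /= /Z indicE pnatr_eq0 eqb0 negbK inE.
  by split.
apply: regular_neq0; split => [t w|w|t t0] //.
- exact: cst_continuous.
- apply: measurable_indic; case: fF => sF _ Fle.
  rewrite (measurable_g_sigmaE (sF t t0)).
  exact: (Fle 0).
Qed.

(** [Y] is the limit of step processes that hold its value at the last grid point strictly before
    the current time; the sets of each step process are built from those of [regular_after] and
    [regular_const]. *)
Lemma left_continuous_regular Y : left_continuous Y -> adapted F Y ->
  process_sets Y `<=` regular_along.
Proof.
move=> lY aY; have sF := filtration_sigma fF.
have sR := sigma_algebra_regular.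
have FT (s : R) : 0 <= s -> F s setT.
  by move=> /sF[F0 FC _]; rewrite -[setT]setD0; exact: FC.
(* Regular sets as the measurable sets of a type: regularity of the sets of a process becomes
   measurability, and its stability under pointwise limits applies. *)
pose S := g_sigma_algebraType regular_along.
(* [K n z / (n+1)] is the last grid point strictly before [z.1]: the predecessor of the ceiling
   makes the inequality strict, and the truncated predecessor gives 0 when [z.1 <= 0]. *)
pose K n (z : S) : nat := (absz (Num.ceil (n.+1%:R * Num.max z.1 0 : R))).-1.
have K_gt n m (z : S) : (m < K n z)%N = (m.+1%:R < n.+1%:R * z.1).
  rewrite /K.
  have c0 : 0 <= Num.ceil (n.+1%:R * Num.max z.1 0).
    by rewrite ceil_ge0 (lt_le_trans (ltrN10 _))// mulr_ge0// le_max lexx orbT.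
  have -> : forall k : nat, (m < k.-1)%N = (m.+1 < k)%N by case.
  rewrite -ltz_nat gez0_abs// ceil_gt_int -[m.+1%:~R]/(m.+1%:R : R).
  have [z0|z0] := leP z.1 0.
    rewrite mulr0 ltNge ler0n; apply/esym/negbTE.
    by rewrite -leNgt (le_trans (mulr_ge0_le0 _ _)).
  by [].
pose Ys (s : R) (z : S) := if s < z.1 then Y s z.2 else Y 0 z.2.
have mYs (s : R) : 0 <= s -> measurable_fun [set: S] (Ys s).
  move=> s0; apply/(measurable_wrtP sR) => B mB.
  have [As A0] : F s (Y s @^-1` B) /\ F 0 (Y 0 @^-1` B).
    split; first exact: ((measurable_wrtP (sF s s0) _).1 (aY s s0)).
    exact: ((measurable_wrtP (sF 0 (lexx 0)) _).1 (aY 0 (lexx 0))).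
  rewrite (_ : _ @^-1` _ = [set z | s < z.1 /\ (Y s @^-1` B) z.2] `|`
      ([set z | (Y 0 @^-1` B) z.2] `&` ~` [set z | s < z.1 /\ setT z.2])).
    rewrite -bigcup2E; apply: regular_bigcup => i; rewrite /bigcup2.
    case: ifP => _; first exact: regular_after.
    case: ifP => _; last exact: regular0.
    apply: regularI; first exact: regular_const.
    by apply: regularC; apply: regular_after => //; exact: FT.
  apply/seteqP; split => z; rewrite /= /Ys.
    by case: ltP => [sz Bz|zs Bz]; [left|right; split => // -[]].
  move=> [[-> //]|[Bz sz]]; case: ifP => // sz'; exfalso; exact: sz.
(* Equal to [Y] at all times [t >= 0]. The value [Y 0] is prolonged to negative times, where nothing
   is known of [Y], so that the limit below holds everywhere. *)
pose Yl (z : S) := if 0 < z.1 then Y z.1 z.2 else Y 0 z.2.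
have mYl : measurable_fun [set: S] Yl.
  apply: (@measurable_fun_cvg _ _ _ _ (fun n z => Ys ((K n z)%:R / n.+1%:R) z)).
    move=> n; apply: (@measurable_fun_glue _ S _ (K n) (fun k => Ys (k%:R / n.+1%:R))).
      have mK m : measurable [set z : S | (m < K n z)%N].
        rewrite measurable_g_sigmaE//.
        apply: (@eq_regular [set z | m.+1%:R / n.+1%:R < z.1 /\ setT z.2]).
          by move=> t w t0 /=; rewrite K_gt ltr_pdivrMr// mulrC; split => [[]|].
        by apply: regular_after; [rewrite divr_ge0|apply: FT; rewrite divr_ge0].
      case=> [|k].
        rewrite (_ : [set _ | _] = ~` [set z : S | (0 < K n z)%N]).
          exact: measurableC.
        by apply/seteqP; split => z /=; case: (K n z).
      rewrite (_ : [set _ | _] = [set z : S | (k < K n z)%N] `&`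
          ~` [set z : S | (k.+1 < K n z)%N]).
        by apply: measurableI => //; exact: measurableC.
      apply/seteqP; split => z /=; first by move=> ->; rewrite ltnn; split.
      by move=> [kK /negP]; rewrite -leqNgt => Kk; apply/eqP; rewrite eqn_leq Kk.
    by move=> k; apply: mYs; rewrite divr_ge0.
  move=> z _; rewrite /Yl /Ys; have [z0|z0] := ltP 0 z.1; last first.
    under eq_fun do rewrite ltNge (le_trans z0) ?divr_ge0//=.
    exact: cvg_cst.
  have K_lt n : (K n z)%:R / n.+1%:R < z.1.
    rewrite ltr_pdivrMr// mulrC; case EK : (K n z) => [|k].
      by rewrite mulr_gt0.
    by rewrite -K_gt EK.
  under eq_fun do rewrite K_lt.
  have /cvg_at_leftP := lY _ z.2 z0; apply; split => //.
  apply: (@squeeze_cvgr _ _ _ _ (fun n => z.1 - n.+1%:R^-1) (fun=> z.1)).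
  - near=> n; rewrite (ltW (K_lt n)) andbT lerBlDr -[X in _ + X]mul1r -mulrDl natr1.
    rewrite ler_pdivlMr// mulrC leNgt -K_gt ltnn.
    by [].
  - rewrite -[X in _ --> X]subr0; apply: cvgB; first exact: cvg_cst.
    exact: cvg_harmonic.
  - exact: cvg_cst.
move=> _ [B mB <-].
apply: (@eq_regular (Yl @^-1` B)).
  move=> t w t0; rewrite /= /Yl /=; split.
    move=> h; split; first by rewrite /time_space; split => //=; rewrite in_itv/= t0.
    by move: h; case: ltP => // t0'; rewrite (_ : t = 0)//; apply/eqP; rewrite eq_le t0'.
  by move=> [_]; case: ltP => // t0'; rewrite (_ : t = 0)//; apply/eqP; rewrite eq_le t0'.
exact: ((measurable_wrtP sR Yl).1 mYl).
Unshelve. all: by end_near. Qed.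

Lemma predictable_regular : predictable_sets F `<=` regular_along.
Proof.
apply: smallest_sub; last by move=> A [Y [lY aY]]; exact: left_continuous_regular.
split; [exact: regular0| |exact: regular_bigcup].
(* Complements of predictable sets are relative to [time_space]; they differ from absolute ones only
   at negative times, which regularity does not see. *)
move=> A rA; apply: (@eq_regular (~` A)); last exact: regularC.
move=> t w t0; split => [nA|[]//]; split => //; split => //=.
by rewrite in_itv/= t0.
Qed.

End regularity.

(** * Announcing stopping times *)

Section hitting_times.
Context d (T : measurableType d) (R : realType) (P : probability T R).
Context (F : R -> set (set T)).
Hypothesis uF : usual_conditions P F.
Let fF : filtration F. Proof. by case: uF. Qed.

Variables (O : R -> T -> Prop) (C : R).
Hypothesis C0 : 0 <= C.
Hypothesis O_adapted : forall t, 0 <= t -> F t [set w | O t w].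
Hypothesis O_open : forall t w, 0 <= t -> O t w -> \forall s \near t^'+, O s w.

(** The horizon [C] bounds the time and keeps the set nonempty, away from the default value of
    [inf]. *)
Definition hitting_time (w : T) : R :=
  inf ([set t | 0 <= t /\ O t w] `|` [set C]).

Let D w := [set t | 0 <= t /\ O t w] `|` [set C].
Let D_ge0 w : lbound (D w) 0.
Proof. by move=> t [[]//|->]. Qed.
Let D_lb w : has_lbound (D w). Proof. by exists 0; exact: D_ge0. Qed.
Let D_n0 w : D w !=set0. Proof. by exists C; right. Qed.

Lemma hitting_time_ge0 w : 0 <= hitting_time w.
Proof. by apply: lb_le_inf; [exact: D_n0|exact: D_ge0]. Qed.

Lemma hitting_time_le w : hitting_time w <= C.
Proof. by apply: ge_inf; [exact: D_lb|right]. Qed.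

Lemma hitting_time_le_hit w t : 0 <= t -> O t w -> hitting_time w <= t.
Proof. by move=> t0 Ot; apply: ge_inf; [exact: D_lb|left]. Qed.

(** By [O_open] a hit persists up to some slightly later rational time, which makes the event a
    countable union; [u <= C] rules out that the infimum comes from the horizon. *)
Lemma hitting_time_lt w u : u <= C -> hitting_time w < u <->
  exists q : rat, [/\ 0 <= ratr q :> R, ratr q < u & O (ratr q) w].
Proof.
move=> uC; split=> [|[q [q0 qu Oq]]]; last first.
  by apply: le_lt_trans qu; exact: hitting_time_le_hit.
move=> /(inf_lt (D_n0 w))[t [[t0 Ot] tu|->]]; last by rewrite ltNge uC.
have [e /= e0 He] := O_open t0 Ot.
have tm : t < Num.min (t + e) u by rewrite lt_min tu ltrDl e0.
have [q] := rat_in_itvoo tm; rewrite in_itv/= lt_min => /and3P[tq qe qu].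
exists q; split => //; first by rewrite (le_trans t0)// ltW.
by apply: He => //=; rewrite distrC gtr0_norm ?subr_gt0// ltrBlDl.
Qed.

(** For each [s > t] the event is a countable intersection of events [{hitting_time < u k}] with
    [u k] decreasing to [t] and at most [s], hence it lies in [F s]; right continuity of the
    filtration concludes. *)
Lemma hitting_time_stopping : bounded_stopping_time F hitting_time.
Proof.
split; [exact: hitting_time_ge0| |by exists C; exact: hitting_time_le].
move=> t t0; rewrite -(usual_right_continuous uF t0) => s /= ts.
have s0 : 0 <= s by rewrite (le_trans t0)// ltW.
have sFs := filtration_sigma fF s0.
rewrite -(measurable_g_sigmaE sFs).
have [Ct|tC] := leP C t.
  rewrite (_ : [set _ | _] = setT)//; apply/seteqP; split => // w _ /=.
  exact: le_trans (hitting_time_le w) Ct.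
(* The cap at [C] keeps [u k <= C], as [hitting_time_lt] requires. *)
pose m := Num.min s C.
have tm : t < m by rewrite lt_min ts.
pose u (k : nat) := t + (m - t) / k.+1%:R.
have ut k : t < u k by rewrite ltrDl divr_gt0// subr_gt0.
have um k : u k <= m.
  rewrite /u -lerBrDl ler_pdivrMr// ler_peMr ?ler1n// subr_ge0 ltW//.
pose L k := \bigcup_q [set w | [/\ 0 <= ratr q :> R, ratr q < u k & O (ratr q) w]].
rewrite (_ : [set _ | _] = \bigcap_k L k); last first.
  apply/seteqP; split => w /=.
    move=> wt k _.
    have /(hitting_time_lt w)[+ _] : u k <= C by rewrite (le_trans (um k))// ge_min lexx orbT.
    by move=> /(_ (le_lt_trans wt (ut k)))[q qw]; exists q.
  move=> Lw; apply/ler_addgt0Pr => e e0.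
  have [k ke] : exists k : nat, (m - t) / k.+1%:R <= e.
    exists (Num.truncn ((m - t) / e)); rewrite ler_pdivrMr// mulrC -ler_pdivrMr//.
    exact/ltW/truncnS_gt.
  have /(hitting_time_lt w)[_ +] : u k <= C by rewrite (le_trans (um k))// ge_min lexx orbT.
  have [q _ qw] := Lw k I.
  move=> /(_ (ex_intro _ q qw)) /ltW /le_trans; apply.
  by rewrite lerD2l.
apply: bigcap_measurableType => k _; apply: bigcupT_measurable_rat => q.
have [/andP[q0 qu]|nq] := boolP ((0 <= ratr q :> R) && (ratr q < u k)).
  rewrite (_ : [set _ | _] = [set w | O (ratr q) w]); last first.
    by apply/seteqP; split => w /=; [case|split].
  rewrite (measurable_g_sigmaE sFs).
  apply: (filtration_nondecreasing fF q0) (O_adapted q0).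
  by rewrite (le_trans (ltW qu))// (le_trans (um k))// ge_min lexx.
rewrite (_ : [set _ | _] = set0)//; apply/seteqP; split => // w /= [q0 qu _].
by move: nq; rewrite q0 qu.
Qed.

End hitting_times.

Section announcing.
Context d (T : measurableType d) (R : realType) (P : probability T R).
Context (F : R -> set (set T)).
Hypothesis uF : usual_conditions P F.
Let fF : filtration F. Proof. by case: uF. Qed.

Variable G : R -> T -> R.
Hypothesis ndG : Defs.nondecreasing G.
Hypothesis aG : adapted F G.
Hypothesis rG : Defs.right_continuous G.
Hypothesis pG : predictable F G.
Variable c : R.

(** It contains [{sup G < c}], and also the paths whose supremum is [c] without being attained. *)
Definition never_reaches : set T := [set w | forall t, 0 <= t -> G t w < c].

Lemma measurable_never_reaches : measurable never_reaches.
Proof.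
rewrite (_ : never_reaches = \bigcap_n [set w | G n%:R w < c]).
  apply: bigcap_measurableType => n _; apply: measurable_sublevel_lt.
  exact: adapted_measurable uF _ aG _ _.
apply/seteqP; split => w /=; first by move=> Nw n _; exact: Nw.
move=> Nw t t0; apply: le_lt_trans (Nw (Num.truncn t).+1 I).
exact/(ndG w t0)/ltW/truncnS_gt.
Qed.

(** The first time that [G >= c]. On [never_reaches] the default value of [inf] makes it 0 instead
    of infinity, so [tau] is handled as a mere random variable, and these paths are excluded from
    [bad] below. *)
Let tau w := inf [set t | 0 <= t /\ c <= G t w].

Let tau_ge0 w : 0 <= tau w.
Proof.
rewrite /tau; have [->|/set0P h] := eqVneq [set t | 0 <= t /\ c <= G t w] set0.
  by rewrite inf0.
by apply: lb_le_inf => // t [].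
Qed.

Let tau_le w t : 0 <= t -> c <= G t w -> tau w <= t.
Proof.
by move=> t0 ct; apply: ge_inf => //; exists 0 => s [].
Qed.

Let tau_never w : never_reaches w -> tau w = 0.
Proof.
move=> Nw; rewrite /tau (_ : [set _ | _] = set0) ?inf0//.
by apply/seteqP; split => // t [t0 /=]; rewrite leNgt Nw.
Qed.

Let tau_reach w : ~ never_reaches w -> c <= G (tau w) w.
Proof.
move=> Nw; rewrite leNgt; apply/negP => Gc.
have [t0 [t00 ct0]] : exists t, 0 <= t /\ c <= G t w.
  apply: contrapT => /forallNP h; apply: Nw => t t0; rewrite ltNge; apply/negP => ct.
  by apply: (h t).
have /cvgr_lt/(_ _ Gc) near_lt := @rG (tau w) w (tau_ge0 w).
near (tau w)^'+ => s.
have ts : tau w < s by near: s; exact: nbhs_right_gt.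
have Gs : G s w < c by near: s.
have [|t [t1 ct] ts'] := inf_lt _ ts; first by exists t0.
by have := lt_le_trans Gs ct; rewrite ltNge (ndG w t1 (ltW ts')).
Unshelve. all: by end_near. Qed.

Let measurable_tau : measurable_fun setT tau.
Proof.
apply: measurable_of_sublevels => // t t0.
rewrite (_ : [set _ | _] = never_reaches `|` [set w | c <= G t w]).
  apply: measurableU; first exact: measurable_never_reaches.
  by apply: measurable_superlevel_ge; exact: adapted_measurable uF _ aG _ _.
apply/seteqP; split => w /=.
  move=> wt; have [Nw|Nw] := pselect (never_reaches w); [by left|right].
  exact: le_trans (tau_reach Nw) (ndG w (tau_ge0 w) wt).
by move=> [/tau_never->//|]; exact: tau_le.
Qed.

(** The predictable set [{G >= c}] contains the graph of [tau] off [never_reaches], and is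
    approximated from inside by zero sets of test processes [Y j]. Entering a neighbourhood
    [{Y j < 1/(n+1)}] of a zero that sits at [tau > 0] happens strictly before [tau], where still
    [G < c]; this is where [G 0 < c] enters. On [never_reaches] the [Y j] are positive, so thin
    enough neighbourhoods are rarely entered before the horizon [C]. *)
Lemma announcing_stopping_time (C e : R) : 0 <= C -> 0 < e ->
  exists sigma, [/\ bounded_stopping_time F sigma,
    forall w, sigma w <= C,
    (P (never_reaches `&` [set w | (sigma w < C)%R]) <= e%:E)%E &
    \forall w \ae P, G 0 w < c -> G (sigma w) w < c].
Proof.
move=> C0 e0.
pose S : set (R * T) := @time_space d T R `&` (fun z => G z.1 z.2) @^-1` `[c, +oo[.
have S_reg : regular_along P F tau S.
  apply: (@predictable_regular _ _ _ P F fF tau measurable_tau tau_ge0); apply: pG.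
  by exists `[c, +oo[%classic => //; exact: measurable_itv.
have SE t w : S (t, w) <-> 0 <= t /\ c <= G t w.
  rewrite /S /time_space /=; split.
    by move=> [[+ _]]; rewrite !in_itv/= !andbT => ? ?; split.
  by move=> [t0 ct]; do 2?split => //; rewrite in_itv/= andbT.
have /choice[Y /choice[Z YZ]] (j : nat) := S_reg j.+1%:R^-1 (ltac:(by rewrite invr_gt0)).
have tY j : test_process F (Y j) by case: (YZ j).
have tZ j : test_process F (Z j) by case: (YZ j).
have YN j w t : never_reaches w -> 0 <= t -> 0 < Y j t w.
  move=> Nw t0; rewrite lt0r (test_ge0 (tY j)) andbT; apply/eqP => Yt.
  have [_ _ + _ _] := YZ j => /(_ _ _ t0 Yt)/SE[_].
  by rewrite leNgt Nw.
pose bad j := ~` never_reaches `&` [set w | Y j (tau w) w != 0].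
have mbad j : measurable (bad j).
  apply: measurableI; first exact/measurableC/measurable_never_reaches.
  exact: measurable_test_neq0 fF _ measurable_tau tau_ge0 _ (tY j).
(* Off [never_reaches] the point [(tau w, w)] lies in [S], so [Z j] cannot vanish there and [bad j]
   is part of the event that regularity controls. *)
have Pbad j : (P (bad j) <= (j.+1%:R^-1)%:E)%E.
  have [_ _ _ ZS +] := YZ j; apply: le_trans; apply: le_measure; rewrite ?inE//.
    by apply: measurableI; exact: measurable_test_neq0 fF _ measurable_tau tau_ge0 _ _.
  move=> w [Nw Yw]; split => //; apply/eqP => Zw.
  by apply: (ZS _ _ (tau_ge0 w) Zw); apply/SE; split => //; exact: tau_reach.
pose E j n := never_reaches `&` \bigcup_q
  [set w | [/\ 0 <= ratr q :> R, ratr q < C & Y j (ratr q) w < n.+1%:R^-1]].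
have mE j n : measurable (E j n).
  apply: measurableI; first exact: measurable_never_reaches.
  apply: bigcupT_measurable_rat => q.
  have [/andP[q0 qC]|nq] := boolP ((0 <= ratr q :> R) && (ratr q < C)).
    rewrite (_ : [set _ | _] = [set w | Y j (ratr q) w < n.+1%:R^-1]); last first.
      by apply/seteqP; split => w /=; [case|split].
    apply: measurable_sublevel_lt.
    exact: adapted_measurable uF _ (test_adapted (tY j)) _ _.
  rewrite (_ : [set _ | _] = set0)//; apply/seteqP; split => // w /= [q0 qC _].
  by move: nq; rewrite q0 qC.
(* On [never_reaches] the continuous path of [Y j] has a positive minimum over [[0, C]], hence it
   does not go below [1/(n+1)] for large [n]. *)
have E0 j : \bigcap_n E j n = set0.
  apply/seteqP; split => // w Ew.
  have [Nw _] := Ew 0%N I.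
  have [|t] := @EVT_min R (Y j ^~ w) 0 C C0.
    by apply: continuous_subspaceT; exact: (test_continuous (tY j)).
  rewrite in_itv/= => /andP[t0 tC] Ymin.
  have Yt := YN j _ _ Nw t0.
  have [_ [q _ [q0 qC]]] := Ew (Num.truncn (Y j t w)^-1) I.
  have /le_lt_trans /[apply] := Ymin (ratr q) (ltac:(by rewrite in_itv/= q0 ltW)).
  rewrite ltNge => /negP; apply.
  rewrite -[leRHS]invrK lef_pV2 ?posrE ?invr_gt0//.
  exact/ltW/truncnS_gt.
have /choice[n nP] j : exists n, (P (E j n) <= (e / (2 ^ j.+1)%:R)%:E)%E.
  apply: nonincreasing_le_measure => //.
    move=> k m km; apply/subsetPset => w [Nw [q _ [q0 qC Yq]]].
    split => //; exists q => //; split => //; apply: lt_le_trans Yq _.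
    by rewrite lef_pV2 ?posrE// ler_nat.
  by rewrite E0 measure0 lte_fin divr_gt0// ltr0n expn_gt0.
(* Off [never_reaches], almost surely some [Y j] vanishes at [tau], so that the
   entrance time into [O] is strictly smaller than [tau]. *)
pose O t w := exists j, Y j t w < (n j).+1%:R^-1.
have O_adapted t : 0 <= t -> F t [set w | O t w].
  move=> t0; rewrite -(measurable_g_sigmaE (filtration_sigma fF t0)).
  rewrite (_ : [set w | _] = \bigcup_j [set w | Y j t w < (n j).+1%:R^-1]).
    apply: bigcupT_measurable => j; apply: measurable_sublevel_lt.
    exact: (test_adapted (tY j)).
  by apply/seteqP; split => w [j]; [exists j|move=> _; exists j].
have O_open t w : 0 <= t -> O t w -> \forall s \near t^'+, O s w.
  move=> t0 [j Yj].
  have /cvg_at_right_filter/cvgr_lt/(_ _ Yj) := @test_continuous _ _ _ _ _ (tY j) w t.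
  by apply: filterS => s Ys; exists j.
pose sigma := hitting_time O C.
have sigmaS : bounded_stopping_time F sigma by exact: hitting_time_stopping uF _ _ _ _ _.
exists sigma; split => //.
- by move=> w; exact: hitting_time_le.
- apply: (@le_trans _ _ (P (\bigcup_j E j (n j)))).
    apply: le_measure; rewrite ?inE.
    + apply: measurableI; first exact: measurable_never_reaches.
      by apply: measurable_sublevel_lt; exact: measurable_stopping_time uF _ sigmaS.
    + exact: bigcupT_measurable.
    + move=> w [Nw /=]; rewrite hitting_time_lt// => -[q [q0 qC [j Yj]]].
      by exists j => //; split => //; exists q.
  apply: (@le_trans _ _ (\sum_(j <oo) P (E j (n j)))%E).
    by apply: measure_sigma_subadditive => //; exact: bigcupT_measurable.
  apply: (@le_trans _ _ (\sum_(j <oo) (e / (2 ^ j.+1)%:R)%:E)%E).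
    by apply: lee_nneseries => // j _; exact: nP.
  by apply: epsilon_trick0; exact: ltW.
(* This intersection is null, since [bad j] has probability at most [1/(j+1)]. Off it, on the paths
   that reach [c], some [Y j] vanishes at [tau]. *)
- exists (\bigcap_j bad j); split.
  + exact: bigcap_measurableType.
  + apply/eqP; rewrite eq_le measure_ge0 andbT; apply/lee_addgt0Pr => r r0.
    rewrite add0e; have [j jr] : exists j : nat, j.+1%:R^-1 <= r.
      exists (Num.truncn r^-1); rewrite -[leRHS]invrK lef_pV2 ?posrE ?invr_gt0//.
      exact/ltW/truncnS_gt.
    apply: (@le_trans _ _ (P (bad j))).
      apply: le_measure; rewrite ?inE//; first exact: bigcap_measurableType.
      exact: bigcap_inf.
    by apply: le_trans (Pbad j) _; rewrite lee_fin.
  + move=> w /= /not_implyP[G0 Gs] j _; split.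
      by move=> Nw; apply: Gs; apply: Nw; exact: hitting_time_ge0.
    apply/eqP => Yw; apply: Gs.
    have sG t : 0 <= t -> t < tau w -> G t w < c.
      by move=> t0 tt; rewrite ltNge; apply/negP => /(tau_le t0); rewrite leNgt tt.
    have [Nw|Nw] := pselect (never_reaches w).
      by apply: Nw; exact: hitting_time_ge0.
    have tau_gt0 : 0 < tau w.
      rewrite lt0r tau_ge0 andbT; apply/eqP => tau0.
      by have := tau_reach Nw; rewrite tau0 leNgt G0.
    apply: sG; first exact: hitting_time_ge0.
    have Yn : Y j (tau w) w < (n j).+1%:R^-1 by rewrite Yw invr_gt0.
    have /cvg_at_left_filter/cvgr_lt/(_ _ Yn) Ynear := @test_continuous _ _ _ _ _ (tY j) w (tau w).
    near (tau w)^'- => t.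
    have Yt : Y j t w < (n j).+1%:R^-1 by near: t.
    have t0 : 0 < t by near: t; exact: nbhs_left_gt.
    have tt : t < tau w by near: t; exact: nbhs_left_lt.
    apply: le_lt_trans tt; apply: hitting_time_le_hit => //; first exact: ltW.
    by exists j.
Unshelve. all: by end_near. Qed.

End announcing.

(** * Domination on the paths that stay below a level *)

Section domination_below_level.
Context d (T : measurableType d) (R : realType) (P : probability T R).
Context (F : R -> set (set T)).
Hypothesis uF : usual_conditions P F.
Let fF : filtration F. Proof. by case: uF. Qed.

Variables X G : R -> T -> R.
Hypothesis XG : dominated_pair P F X G.

Local Open Scope ereal_scope.

(** On [never_reaches] the announcing time equals the horizon [n] up to a rare event, so [X n] may
    be replaced by the value of [X] at that time; there domination applies, and [G] is at most
    [min (sup G) c]. The truncation of [X] at height [n] bounds the loss on the rare event. *)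
Lemma integral_sup_never_reaches (A : set T) (c : R) : F 0%R A -> (0 <= c)%R ->
  \int[P]_(w in A `&` never_reaches G c) sup_process X w <=
  \int[P]_(w in A) mine (sup_process G w) c%:E.
Proof.
move=> FA c0; have [ndX X0 aX rX ndG G0 aG rG pG _] := XG.
have mX := adapted_measurable uF aX; have mG := adapted_measurable uF aG.
have sF0 := filtration_sigma fF (lexx 0).
have mA : measurable A by exact: filtration_measurable fF _ (lexx 0) _ FA.
pose N := never_reaches G c.
have mN : measurable N by exact: measurable_never_reaches uF _ ndG aG _.
have mAN : measurable (A `&` N) by exact: measurableI.
have mg : measurable_fun setT (fun w => mine (sup_process G w) c%:E).
  apply: measurable_mine; last exact: measurable_cst.
  exact: measurable_sup_process.
have g0 w : 0 <= mine (sup_process G w) c%:E.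
  by rewrite le_min sup_process_ge0.
pose f (n : nat) w := (Num.min (X n%:R w) n%:R)%:E.
have f0 n w : 0 <= f n w by rewrite lee_fin le_min X0// ler0n.
have mf n : measurable_fun setT (f n).
  apply/measurable_EFinP; apply: measurable_minr; last exact: measurable_cst.
  exact: mX.
have ndf w : nondecreasing_seq (f ^~ w).
  move=> m n mn; rewrite lee_fin le_min !ge_min ler_nat mn orbT andbT.
  by rewrite ndX// ler_nat.
have cf w : f n w @[n --> \oo] --> sup_process X w.
  have -> : sup_process X w = ereal_sup (range (f ^~ w)).
    apply/eqP; rewrite eq_le; apply/andP; split.
      rewrite -(cvg_lim _ (@cvg_sup_process _ _ _ X w ndX))//.
      apply: lime_le; first by apply/cvg_ex; exists (sup_process X w); exact: cvg_sup_process.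
      apply: nearW => n.
      pose k := maxn n (Num.truncn (X n%:R w)).+1.
      apply: (@le_trans _ _ (f k w)); last by apply: ereal_sup_ubound; exists k.
      rewrite lee_fin le_min ndX ?ler_nat ?leq_maxl//=.
      apply: (@le_trans _ _ (Num.truncn (X n%:R w)).+1%:R).
        exact/ltW/truncnS_gt.
      by rewrite ler_nat leq_maxr.
    apply: ge_ereal_sup => _ [n _ <-].
    apply: le_trans (le_sup_process X w (ler0n R n)).
    by rewrite lee_fin ge_min lexx.
  exact: ereal_nondecreasing_cvgn.
have fle n : \int[P]_(w in A `&` N) f n w <= \int[P]_(w in A) mine (sup_process G w) c%:E.
  apply/lee_addgt0Pr => e e0.
  (* With [f n] bounded by [n], an event of probability [e / n.+1] costs less than [e]. *)
  have en0 : (0 < e / n.+1%:R)%R by rewrite divr_gt0.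
  have [s [sS sn Ps sG]] := announcing_stopping_time uF ndG aG rG pG c (ler0n R n) en0.
  have s0 : forall w, (0 <= s w)%R by case: sS.
  have ms := measurable_stopping_time uF sS.
  have mXs : measurable_fun setT (at_time X s).
    apply/measurable_EFinP; exact: measurable_at_random_time.
  have mGs : measurable_fun setT (at_time G s).
    apply/measurable_EFinP; exact: measurable_at_random_time.
  have Xs0 w : 0 <= at_time X s w by rewrite lee_fin X0.
  have Gs0 w : 0 <= at_time G s w by rewrite lee_fin G0.
  pose B := [set w | (s w < n%:R)%R].
  have mB : measurable B by exact: measurable_sublevel_lt.
  (* Domination is available only on sets of [F 0], and [never_reaches] is not one in general. It is
     enlarged to [{G 0 < c}], where the value of [G] at [s] is still almost surely below [c]. *)
  pose A0 := A `&` [set w | (G 0 w < c)%R].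
  have FA0 : F 0%R A0.
    rewrite -(measurable_g_sigmaE sF0); apply: measurableI.
      by rewrite (measurable_g_sigmaE sF0).
    by apply: measurable_sublevel_lt; exact: aG.
  have mA0 : measurable A0 by exact: filtration_measurable fF _ (lexx 0) _ FA0.
  have mI : measurable_fun setT (fun w => n%:R%:E * (\1_B w)%:E : \bar R).
    apply: measurable_funeM; apply/measurable_EFinP.
    exact: measurable_indic.
  apply: (@le_trans _ _ (\int[P]_(w in A `&` N) (at_time X s w + n%:R%:E * (\1_B w)%:E))).
    apply: ge0_le_integral => //.
    - exact: measurable_funTS.
    - by apply: emeasurable_funD; exact: measurable_funTS.
    move=> w _; rewrite /at_time -EFinM -EFinD lee_fin indicE.
    have [wB|wB] := boolP (w \in B).
      rewrite mulr1 ge_min; apply/orP; right.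
      by rewrite lerDr X0.
    rewrite mulr0 addr0 ge_min; apply/orP; left.
    have -> : s w = n%:R; last exact: lexx.
    apply/eqP; rewrite eq_le sn leNgt; apply/negP => sw.
    by move: wB; rewrite notin_setE; apply.
  rewrite ge0_integralD//; last 2 first.
  - exact: measurable_funTS.
  - exact: measurable_funTS.
  apply: leeD.
    apply: (@le_trans _ _ (\int[P]_(w in A0) at_time X s w)).
      apply: ge0_subset_integral => //; first exact: measurable_funTS.
      by move=> w [Aw Nw]; split => //=; exact: Nw.
    apply: le_trans (domination_integral uF XG sS FA0) _.
    apply: (@le_trans _ _ (\int[P]_(w in A0) mine (sup_process G w) c%:E)).
      apply: ae_ge0_le_integral => //; try exact: measurable_funTS.
      apply: filterS sG => w /[swap] -[_ /= Gc] /(_ Gc) /ltW Gs.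
      by rewrite le_min [X in _ && X]lee_fin Gs andbT le_sup_process.
    apply: ge0_subset_integral => //; first exact: measurable_funTS.
    by move=> w [].
  rewrite ge0_integralZl_EFin//; last first.
    by apply: measurable_funTS; apply/measurable_EFinP; exact: measurable_indic.
  rewrite integral_indic//.
  apply: (@le_trans _ _ (n%:R%:E * (e / n.+1%:R)%:E)).
    apply: lee_pmul => //; apply: le_trans Ps.
    apply: le_measure; rewrite ?inE; [exact: measurableI|exact: measurableI|].
    by move=> w [Bw [_ Nw]].
  rewrite -EFinM lee_fin mulrCA; apply: ler_piMr; first exact: ltW.
  by rewrite ler_pdivrMr// mul1r ler_nat.
have cvgf : \int[P]_(w in A `&` N) f n w @[n --> \oo] --> \int[P]_(w in A `&` N) sup_process X w.
  have -> : \int[P]_(w in A `&` N) sup_process X w = \int[P]_(w in A `&` N) limn (f ^~ w).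
    by apply: eq_integral => w _; rewrite (cvg_lim _ (cf w)).
  apply: cvg_monotone_convergence => //.
  by move=> n; exact: measurable_funTS.
rewrite -(cvg_lim _ cvgf)//.
apply: lime_le; first by apply/cvg_ex; eexists; exact: cvgf.
exact: nearW.
Qed.

End domination_below_level.

(** * From truncated means to moments *)

Section power_inequalities.
Context (R : realType).
Implicit Types (p r u x y e g : R).

(** The tangent at [u = 1] of a concave power, obtained from Young's inequality with exponents [1/p]
    and [1/(1-p)]. *)
Lemma powR_le_affine p u : 0 < p -> p < 1 -> 0 <= u -> u `^ p <= p * u + (1 - p).
Proof.
move=> p0 p1 u0; have p1' : 0 < 1 - p by rewrite subr_gt0.
have := @conjugate_powR R (u `^ p) 1 p^-1 (1 - p)^-1 (powR_ge0 _ _) ler01.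
rewrite !invrK !invr_gt0 => /(_ p0 p1' (subrKC _ _)).
by rewrite mulr1 -powRrM divff ?gt_eqF// powRr1// powR1 mul1r mulrC.
Qed.

(** In the weighted geometric mean of [r^(p-1)] and [r^p] the exponents [p (p-1)] and [(1-p) p]
    cancel. *)
Lemma powR_weighted_AMGM p r : 0 < p -> p < 1 -> 0 < r ->
  1 <= p * r `^ (p - 1) + (1 - p) * r `^ p.
Proof.
move=> p0 p1 r0; have p1' : 0 < 1 - p by rewrite subr_gt0.
have := @conjugate_powR R (r `^ (p * (p - 1))) (r `^ (p * (1 - p))) p^-1 (1 - p)^-1
  (powR_ge0 _ _) (powR_ge0 _ _).
rewrite !invrK !invr_gt0 => /(_ p0 p1' (subrKC _ _)).
rewrite -powRD; last by apply/implyP => _; rewrite gt_eqF.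
rewrite -mulrDr subrKA subrr mulr0 powRr0 -!powRrM.
rewrite mulfK ?gt_eqF// mulrAC divff ?gt_eqF// mul1r.
by rewrite [_ * p]mulrC [_ * (1 - p)]mulrC.
Qed.

(* [powR_le_affine] at [u = p x / y]. *)
Lemma powR_split p x y : 0 < p -> p < 1 -> 0 <= x -> 0 < y ->
  p `^ p * x `^ p <= p ^+ 2 * (x * y `^ (p - 1)) + (1 - p) * y `^ p.
Proof.
move=> p0 p1 x0 y0.
have u0 : 0 <= p * x / y by rewrite divr_ge0// ?mulr_ge0// ltW.
have := powR_le_affine p0 p1 u0.
have yp : 0 < y `^ p by rewrite powR_gt0.
have y_ge0 := ltW y0; have p_ge0 := ltW p0.
rewrite -(ler_pM2r yp) -(powRM _ u0 y_ge0) divfK; last by rewrite gt_eqF.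
rewrite (powRM _ p_ge0 x0) => /le_trans; apply; rewrite mulrDl lerD2r.
rewrite powRB; last by apply/implyP => _; rewrite gt_eqF.
rewrite (powRr1 y_ge0) le_eqVlt; apply/orP; left; apply/eqP; field.
by rewrite gt_eqF.
Qed.

End power_inequalities.

Section geometric_levels.
Context (R : realType) (p r e : R).
Hypotheses (p0 : 0 < p) (p1 : p < 1) (r1 : 1 < r) (e0 : 0 < e).

(* The weights and the levels discretize [y^(p-1) = (1-p) int_y^oo c^(p-2) dc]. *)
Definition level (k : nat) : R := e * r ^+ k.

(* [level k `^ (p - 1) - level k.+1 `^ (p - 1)] *)
Definition weight (k : nat) : R :=
  e `^ (p - 1) * (r `^ (p - 1)) ^+ k * (1 - r `^ (p - 1)).

Let r0 : 0 < r. Proof. exact: lt_trans r1. Qed.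
Let r_ge0 : 0 <= r := ltW r0.
Let e_ge0 : 0 <= e := ltW e0.
Let p_ge0 : 0 <= p := ltW p0.
Let rho : R := r `^ (p - 1).
Let rho0 : 0 < rho. Proof. exact: powR_gt0. Qed.
Let rho1 : rho < 1.
Proof.
rewrite /rho -opprB powRN invf_lt1 ?powR_gt0//.
have := @gt0_ltr_powR R (1 - p); rewrite subr_gt0 => /(_ p1 1 r).
by rewrite powR1 !nnegrE ler01 (ltW r0); exact.
Qed.

Lemma level_gt0 k : 0 < level k. Proof. by rewrite mulr_gt0// exprn_gt0. Qed.

Lemma weight_gt0 k : 0 < weight k.
Proof.
by rewrite /weight !mulr_gt0 ?subr_gt0 ?exprn_gt0 ?powR_gt0.
Qed.

Let powR_exprn (a q : R) k : 0 <= a -> (a ^+ k) `^ q = (a `^ q) ^+ k.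
Proof.
by move=> a0; rewrite -powR_mulrn// -powRrM mulrC powRrM powR_mulrn// powR_ge0.
Qed.

Let level_powR k : level k `^ (p - 1) = e `^ (p - 1) * rho ^+ k.
Proof. by rewrite powRM ?exprn_ge0// powR_exprn. Qed.

(** The increments of the antiderivative [((1-p)/p) c^p] of [(1-p) c^(p-1)] bound the discrete
    terms. Up to a common factor this is [powR_weighted_AMGM] at [r], so no factor of [r] is
    lost. *)
Let weight_level k : p * (weight k * level k) <= (1 - p) * (level k.+1 `^ p - level k `^ p).
Proof.
have rp : rho * r = r `^ p.
  by rewrite mulrC mulr_powRB1.
have ep : e `^ (p - 1) * e = e `^ p.
  by rewrite mulrC mulr_powRB1.
rewrite /level !powRM ?exprn_ge0// !powR_exprn// exprS.
rewrite (_ : weight k * _ = e `^ p * (r `^ p) ^+ k * (1 - rho)); last first.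
  by rewrite /weight -/rho -ep -rp exprMn; ring.
rewrite (_ : (1 - p) * _ = e `^ p * (r `^ p) ^+ k * ((1 - p) * (r `^ p - 1))); last by ring.
rewrite mulrCA ler_pM2l; last by rewrite mulr_gt0 ?exprn_gt0 ?powR_gt0.
by have := powR_weighted_AMGM p0 p1 r0; rewrite -/rho; lra.
Qed.

Variable g : R.
Hypothesis g0 : 0 <= g.
Let y := Num.max g e.

Let y_gt0 : 0 < y. Proof. by rewrite lt_max e0 orbT. Qed.
Let y_ge0 : 0 <= y := ltW y_gt0.
Let ry_ge0 : 0 <= r * y. Proof. exact: mulr_ge0. Qed.
Let level_ge0 k : 0 <= level k := ltW (level_gt0 k).

Lemma level_le k l : (k <= l)%N -> level k <= level l.
Proof.
by move=> kl; rewrite ler_pM2l// ler_weXn2l// ltW.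
Qed.

(** The index at which [min g (level k)] switches from [level k] to [g]. This level exceeds [y] by a
    factor of at most [r], which is the whole loss of the discretization; Bernoulli's inequality for
    [r ^+ n] shows that such an index exists. *)
Lemma first_level : exists j, [/\ forall k, (k < j)%N -> level k <= g,
  forall k, (j <= k)%N -> g < level k & y <= level j <= r * y].
Proof.
have ex : exists k, g < level k.
  have rr : 0 < r - 1 by rewrite subr_gt0.
  exists (Num.truncn (g / (e * (r - 1)))).+1.
  set k := _.+1; apply: (@lt_le_trans _ _ (e * (k%:R * (r - 1)))).
    rewrite mulrCA -ltr_pdivrMr ?mulr_gt0//; exact: truncnS_gt.
  rewrite ler_pM2l//.
  have : forall n, n%:R * (r - 1) + 1 <= r ^+ n.
    elim=> [|n IH]; first by rewrite mul0r add0r expr0.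
    rewrite exprS -natr1; apply: (@le_trans _ _ (r * (n%:R * (r - 1) + 1))).
      have : 0 <= n%:R * ((r - 1) * (r - 1)) by rewrite mulr_ge0// mulr_ge0// ltW.
      by nra.
    by rewrite ler_pM2l.
  by move=> /(_ k); lra.
have [j gj jmin] := ex_minnP ex.
exists j; split.
- by move=> k kj; rewrite leNgt; apply: contraL kj => /jmin; rewrite -leqNgt.
- by move=> k jk; exact: lt_le_trans gj (level_le jk).
have ey : e <= y by rewrite le_max lexx orbT.
apply/andP; split.
  rewrite ge_max ltW//= -[leLHS]mulr1 -(expr0 r); exact: level_le.
case: j gj jmin => [|j] gj jmin.
  by rewrite /level expr0 mulr1 (le_trans ey)// ler_peMl ?ltW.
rewrite /level exprS mulrCA ler_pM2l// -/(level j).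
apply: (@le_trans _ _ g); last by rewrite le_max lexx.
by rewrite leNgt; apply/negP => /jmin; rewrite ltnn.
Qed.

Let sum_weight n m : \sum_(n <= k < n + m) weight k = level n `^ (p - 1) - level (n + m) `^ (p - 1).
Proof.
elim: m => [|m IH]; first by rewrite addn0 big_geq// subrr.
rewrite addnS big_nat_recr ?leq_addr//= IH !level_powR /weight -/rho exprS; ring.
Qed.

(** Below [j] the terms add up to at most [((1-p)/p) (level j)^p] by [weight_level]; from [j] on the
    weights telescope to at most [(level j)^(p-1)], multiplied by [g]. Both powers are bounded
    through [level j <= r y], and [(1-p)/p + 1 = 1/p]. *)
Lemma sum_weight_min_le K :
  \sum_(0 <= k < K) weight k * Num.min g (level k) <= r `^ p / p * y `^ p.
Proof.
have [j [gk kg /andP[yj jy]]] := first_level.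
have ub : (1 - p) / p * level j `^ p + g * level j `^ (p - 1) <= r `^ p / p * y `^ p.
  have ly : level j `^ p <= r `^ p * y `^ p.
    by rewrite -powRM// ge0_ler_powR ?nnegrE.
  have gl : g * level j `^ (p - 1) <= r `^ p * y `^ p.
    apply: (@le_trans _ _ (level j * level j `^ (p - 1))).
      by rewrite ler_wpM2r ?powR_ge0// ltW// kg.
    by rewrite mulr_powRB1.
  rewrite [leRHS]mulrAC; set v := r `^ p * y `^ p in ly gl *.
  rewrite (_ : v / p = (1 - p) / p * v + v); last by field; rewrite gt_eqF.
  by rewrite lerD// ler_wpM2l// divr_ge0// subr_ge0 ltW.
apply: le_trans ub.
have small n : (n <= j)%N -> \sum_(0 <= k < n) weight k * Num.min g (level k) <=
    (1 - p) / p * level n `^ p.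
  elim: n => [|n IH] nj.
    by rewrite big_geq// mulr_ge0 ?powR_ge0// divr_ge0// subr_ge0 ltW.
  rewrite big_nat_recr//= min_r ?gk//.
  have := IH (ltnW nj); have := weight_level n.
  rewrite -(ler_pM2l (_ : 0 < p^-1)) ?invr_gt0// mulKf ?gt_eqF//.
  lra.
have [Kj|jK] := leqP K j.
  apply: le_trans (small K Kj) _; rewrite -[leLHS]addr0 lerD//.
    rewrite ler_wpM2l//; first by rewrite divr_ge0// subr_ge0 ltW.
    by rewrite ge0_ler_powR ?nnegrE// level_le.
  by rewrite mulr_ge0 ?powR_ge0.
rewrite (big_cat_nat _ (n := j))//=; last exact: ltnW.
apply: lerD; first exact: small.
rewrite (eq_big_nat _ _ (F2 := fun k => g * weight k)); last first.
  by move=> k /andP[jk _]; rewrite (min_l (ltW (kg k jk))) mulrC.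
rewrite -mulr_sumr ler_wpM2l//.
by rewrite -(subnKC (ltnW jK)) sum_weight gerBl powR_ge0.
Qed.

Local Open Scope ereal_scope.

(** The weights of the levels above [g] telescope to [(level j)^(p-1)], and [level j <= r y] costs
    the factor [r^(p-1)]. If [x] is infinite, the single term of index [j] is infinite already. *)
Lemma nneseries_weight_ge (x : \bar R) : 0 <= x ->
  (r `^ (p - 1) * y `^ (p - 1))%:E * x <=
  \sum_(k <oo) (weight k)%:E * (x * (g < level k)%R%:R%:E).
Proof.
move=> x0; have [j [gk kg /andP[yj jy]]] := first_level.
have t0 k : 0 <= (weight k)%:E * (x * (g < level k)%R%:R%:E).
  by rewrite mule_ge0 ?lee_fin ?(ltW (weight_gt0 _))// mule_ge0// lee_fin.
case: x x0 t0 => [x| |]// x0 t0; last first.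
  rewrite (_ : (\sum_(k <oo) _) = +oo) ?leey//.
  apply/eqP; rewrite -leye_eq.
  apply: le_trans (nneseries_lim_ge j.+1 (fun k _ _ => t0 k)).
  rewrite big_nat_recr//= kg// mulr1n mule1 gt0_muley ?lte_fin ?weight_gt0//.
  by rewrite addey// -ltNye (lt_le_trans (ltNyr 0))// sume_ge0.
have Kcvg : (level (j + K) `^ (p - 1))%R @[K --> \oo] --> (0%R : R).
  under eq_fun do rewrite level_powR exprD mulrA.
  by apply: cvg_geometric; rewrite ger0_norm ?ltW.
have : ((level j `^ (p - 1) - level (j + K) `^ (p - 1)) * x)%:E @[K --> \oo] -->
    (level j `^ (p - 1) * x)%:E.
  apply: cvg_EFin; first exact: nearW.
  rewrite /comp/=; apply: cvgM; last exact: cvg_cst.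
  rewrite -[X in _ --> X]subr0; apply: cvgB; [exact: cvg_cst|exact: Kcvg].
move=> cK.
apply: (@le_trans _ _ (level j `^ (p - 1) * x)%:E).
  rewrite -EFinM lee_fin ler_wpM2r// -powRM//.
  rewrite -![(p - 1)%R]opprB !powRN lef_pV2 ?posrE ?powR_gt0 ?level_gt0 ?mulr_gt0//.
  by rewrite ge0_ler_powR ?nnegrE ?subr_ge0// ltW.
rewrite -(cvg_lim _ cK)//; apply: lime_le; first by apply/cvg_ex; eexists; exact: cK.
apply: nearW => K.
apply: le_trans (nneseries_lim_ge (j + K) (fun k _ _ => t0 k)).
rewrite (big_cat_nat _ (n := j)) ?leq_addr//= -[leLHS]add0e leeD ?sume_ge0//.
rewrite (eq_big_nat _ _ (F2 := fun k => (weight k * x)%:E)); last first.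
  by move=> k /andP[jk _]; rewrite kg// mulr1n mule1 EFinM.
by rewrite sumEFin -mulr_suml sum_weight.
Qed.

End geometric_levels.

(** * Integration over the levels *)

Section moment_transfer.
Context d (T : measurableType d) (R : realType) (P : probability T R).
Variables (A : set T) (x g : T -> \bar R) (p : R).
Hypotheses (mA : measurable A) (mx : measurable_fun setT x)
  (mg : measurable_fun setT g).
Hypotheses (x0 : forall w, (0 <= x w)%E) (g0 : forall w, (0 <= g w)%E).
Hypotheses (p0 : 0 < p) (p1 : p < 1).
Local Open Scope ereal_scope.
Hypothesis xg : forall c : R, (0 <= c)%R ->
  \int[P]_(w in A `&` [set w | g w < c%:E]) x w <= \int[P]_(w in A) mine (g w) c%:E.

Section fixed_levels.
Variables r e : R.
Hypotheses (r1 : (1 < r)%R) (e0 : (0 < e)%R).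

Let r0 : (0 < r)%R. Proof. exact: lt_trans r1. Qed.
Let y w := maxe (g w) e%:E.
Let b k w : \bar R := (\1_[set v | (g v < (level r e k)%:E)%E] w : R)%:E.
Let c_ k : R := level r e k.
Let w_ k : R := weight p r e k.
Let w_ge0 k : (0 <= w_ k)%R. Proof. exact/ltW/weight_gt0. Qed.

Let y_ge0 w : 0 <= y w. Proof. by rewrite le_max g0. Qed.

Let my : measurable_fun setT y.
Proof. by apply: measurable_maxe => //; exact: measurable_cst. Qed.

Let b_ge0 k w : 0 <= b k w. Proof. by rewrite lee_fin. Qed.

Let mlt k : measurable [set w | g w < (c_ k)%:E].
Proof.
rewrite -[X in measurable X]setTI.
exact: (@measurable_lte _ T R setT measurableT g (cst (c_ k)%:E)).
Qed.

Let mb k : measurable_fun setT (b k).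
Proof. by apply/measurable_EFinP; exact: measurable_indic. Qed.

(** The discretized form of [x y^(p-1)]. *)
Let S w := \sum_(k <oo) (w_ k)%:E * (x w * b k w).

Let S_ge0 w : 0 <= S w.
Proof.
by apply: nneseries_ge0 => k _ _; rewrite mule_ge0 ?lee_fin// mule_ge0.
Qed.

Let mxb k : measurable_fun setT (fun w => x w * b k w).
Proof. exact: emeasurable_funM. Qed.

Let mS : measurable_fun setT S.
Proof.
apply: ge0_emeasurable_sum => [k w _ _|k _].
  by rewrite mule_ge0 ?lee_fin// mule_ge0.
exact: measurable_funeM.
Qed.

(** [powR_split] with [x y^(p-1)] replaced by [S]; the factor [r^(1-p)] offsets the one of
    [nneseries_weight_ge]. Infinite values of [g] and of [x] make the right-hand side infinite. *)
Let pointwise_split w :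
  (p `^ p)%:E * x w `^ p <=
  (p ^+ 2 * r `^ (1 - p))%:E * S w + (1 - p)%:E * y w `^ p.
Proof.
have q0 : (0 < 1 - p)%R by rewrite subr_gt0.
have C0 : (0 < p ^+ 2 * r `^ (1 - p))%R by rewrite mulr_gt0 ?exprn_gt0 ?powR_gt0.
case Eg : (g w) (g0 w) => [a| |]// a0; last first.
  rewrite /y Eg maxye poweRyr ?gt_eqF// gt0_muley ?lte_fin// addey ?leey//.
  by rewrite -ltNye (lt_le_trans (ltNyr 0))// mule_ge0// lee_fin ltW.
have := nneseries_weight_ge p1 r1 e0 a (x0 w).
rewrite (_ : \sum_(k <oo) _ = S w); last first.
  apply: eq_eseriesr => k _; rewrite /b indicE; congr (_ * (_ * (nat_of_bool _)%:R%:E)).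
  by rewrite -(lte_fin a) -Eg; apply/idP/idP; rewrite inE.
have yE : y w = (Num.max a e)%:E by rewrite /y Eg EFin_max.
have y_gt0 : (0 < Num.max a e)%R by rewrite lt_max e0 orbT.
move=> Sx.
rewrite yE poweR_EFin.
have [xy|] := eqVneq (x w) +oo.
  rewrite (_ : S w = +oo) ?gt0_muley ?lte_fin// ?addye ?leey//.
    apply/eqP; rewrite -leye_eq; apply: le_trans Sx.
    by rewrite xy gt0_muley// lte_fin mulr_gt0// powR_gt0.
rewrite -ltey => xfin.
case Ex : (x w) (x0 w) xfin Sx => [u| |]// u0 _ Sx.
apply: (@le_trans _ _ (p ^+ 2 * (u * Num.max a e `^ (p - 1)) + (1 - p) * Num.max a e `^ p)%:E).
  by rewrite poweR_EFin -EFinM lee_fin powR_split.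
rewrite EFinD leeD// ?EFinM//.
rewrite -!EFinM (_ : (_ * _)%:E = (p ^+ 2 * r `^ (1 - p))%:E *
    ((r `^ (p - 1) * Num.max a e `^ (p - 1))%:E * u%:E)).
  by rewrite lee_pmul2l.
rewrite -!EFinM; congr EFin.
have -> : (r `^ (1 - p) = (r `^ (p - 1))^-1)%R by rewrite -powRN opprB.
by field; rewrite gt_eqF// powR_gt0.
Qed.

Let weighted_min_le w :
  \sum_(k <oo) (w_ k)%:E * mine (g w) (c_ k)%:E <= (r `^ p / p)%:E * y w `^ p.
Proof.
have C0 : (0 < r `^ p / p)%R by rewrite divr_gt0// powR_gt0.
case Eg : (g w) (g0 w) => [a| |]// a0; last first.
  by rewrite /y Eg maxye poweRyr ?gt_eqF// gt0_muley ?lte_fin// leey.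
apply: lime_le.
  apply: is_cvg_nneseries => k _ _; rewrite mule_ge0 ?lee_fin// le_min a0.
  by rewrite lee_fin ltW// level_gt0.
apply: nearW => K; rewrite /y Eg -EFin_max poweR_EFin -EFinM.
under eq_bigr do rewrite -EFin_min -EFinM.
by rewrite sumEFin lee_fin sum_weight_min_le.
Qed.

(** Integrating [pointwise_split] and applying [xg] at each level leaves the coefficient [p^2
    r^(1-p) (r^p / p) + (1 - p) = p r + 1 - p], which is at most [r]; the last term comes from
    [y^p <= g^p + e^p]. *)
Lemma moment_transfer_level :
  (p `^ p)%:E * \int[P]_(w in A) x w `^ p <=
  r%:E * (\int[P]_(w in A) g w `^ p + (e `^ p)%:E).
Proof.
have q0 : (0 < 1 - p)%R by rewrite subr_gt0.
have C0 : (0 < p ^+ 2 * r `^ (1 - p))%R by rewrite mulr_gt0 ?exprn_gt0 ?powR_gt0.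
have mpow (f : T -> \bar R) : measurable_fun setT f -> measurable_fun setT (fun w => f w `^ p).
  by move=> mf; exact: (measurableT_comp (measurable_poweR p)).
have mxp := mpow _ mx; have mgp := mpow _ mg; have myp := mpow _ my.
have Sle : \int[P]_(w in A) S w <= (r `^ p / p)%:E * \int[P]_(w in A) y w `^ p.
  rewrite integral_nneseries//; last 2 first.
  - by move=> k; apply: measurable_funTS; exact: measurable_funeM.
  - by move=> k w _; rewrite mule_ge0 ?lee_fin// mule_ge0.
  apply: (@le_trans _ _ (\sum_(k <oo) \int[P]_(w in A) ((w_ k)%:E * mine (g w) (c_ k)%:E))).
    apply: lee_nneseries => [k _ _|k _].
      by apply: integral_ge0 => w _; rewrite mule_ge0 ?lee_fin// mule_ge0.
    have c0 : (0 <= c_ k)%R by rewrite ltW// level_gt0.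
    rewrite !ge0_integralZl_EFin//; last 4 first.
    - by move=> w _; rewrite le_min g0 lee_fin.
    - by apply: measurable_funTS; apply: measurable_mine => //; exact: measurable_cst.
    - by move=> w _; rewrite mule_ge0.
    - exact: measurable_funTS.
    rewrite lee_wpmul2l ?lee_fin//; apply: le_trans (xg c0).
    rewrite integral_mkcondr; apply: ge0_le_integral => //.
    - by move=> w _; rewrite mule_ge0.
    - exact: measurable_funTS.
    - apply: measurable_funTS; apply/(measurable_restrictT _ _).1 => //.
      exact: measurable_funTS.
    - move=> w _; rewrite patchE /b indicE; case: ifP => _; first by rewrite mule1.
      by rewrite mule0.
  rewrite -integral_nneseries//; last 2 first.
  - move=> k; apply: measurable_funTS; apply: measurable_funeM.
    by apply: measurable_mine => //; exact: measurable_cst.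
  - move=> k w _; rewrite mule_ge0 ?lee_fin// le_min g0 lee_fin ltW//.
    exact: level_gt0.
  rewrite -ge0_integralZl_EFin//; last 3 first.
  - by move=> w _; exact: poweR_ge0.
  - exact: measurable_funTS.
  - by rewrite divr_ge0 ?powR_ge0 ?ltW.
  apply: ge0_le_integral => //.
  - move=> w _; apply: nneseries_ge0 => k _ _; rewrite mule_ge0 ?lee_fin// le_min g0 lee_fin ltW//.
    exact: level_gt0.
  - apply: measurable_funTS; apply: ge0_emeasurable_sum => [k w _ _|k _].
      rewrite mule_ge0 ?lee_fin// le_min g0 lee_fin ltW//; exact: level_gt0.
    by apply: measurable_funeM; apply: measurable_mine => //; exact: measurable_cst.
  - by apply: measurable_funTS; exact: measurable_funeM.
have yle : \int[P]_(w in A) y w `^ p <= \int[P]_(w in A) g w `^ p + (e `^ p)%:E.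
  apply: (@le_trans _ _ (\int[P]_(w in A) (g w `^ p + (e `^ p)%:E))).
    apply: ge0_le_integral => //.
    - by move=> w _; exact: poweR_ge0.
    - exact: measurable_funTS.
    - by apply: emeasurable_funD; [exact: measurable_funTS|exact: measurable_cst].
    - move=> w _; rewrite /y /maxe; case: ifP => _.
        by rewrite poweR_EFin leeDr// poweR_ge0.
      by rewrite leeDl// lee_fin powR_ge0.
  rewrite ge0_integralD//; last 3 first.
  - by move=> w _; exact: poweR_ge0.
  - exact: measurable_funTS.
  - by move=> w _; rewrite lee_fin powR_ge0.
  rewrite leeD2l// integral_cst// -[leRHS]mule1 lee_wpmul2l ?lee_fin ?powR_ge0//.
  exact: probability_le1.
rewrite -ge0_integralZl_EFin//; last 3 first.
- by move=> w _; exact: poweR_ge0.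
- exact: measurable_funTS.
- exact: powR_ge0.
apply: (@le_trans _ _ (\int[P]_(w in A)
    ((p ^+ 2 * r `^ (1 - p))%:E * S w + (1 - p)%:E * y w `^ p))).
  apply: ge0_le_integral => //.
  - by move=> w _; rewrite mule_ge0 ?poweR_ge0// lee_fin powR_ge0.
  - by apply: measurable_funTS; exact: measurable_funeM.
  - by apply: measurable_funTS; apply: emeasurable_funD; exact: measurable_funeM.
rewrite ge0_integralD//; last 4 first.
- by move=> w _; rewrite mule_ge0// lee_fin ltW.
- by apply: measurable_funTS; exact: measurable_funeM.
- by move=> w _; rewrite mule_ge0 ?poweR_ge0// lee_fin ltW.
- by apply: measurable_funTS; exact: measurable_funeM.
rewrite !ge0_integralZl_EFin//; last 5 first.
- by move=> w _; exact: poweR_ge0.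
- exact: measurable_funTS.
- exact: ltW.
- exact: measurable_funTS.
- exact: ltW.
apply: (@le_trans _ _ ((p ^+ 2 * r `^ (1 - p))%:E * ((r `^ p / p)%:E * \int[P]_(w in A) y w `^ p)
   + (1 - p)%:E * \int[P]_(w in A) y w `^ p)).
  by rewrite leeD2r// lee_wpmul2l// lee_fin ltW.
have I0 : 0 <= \int[P]_(w in A) y w `^ p by apply: integral_ge0 => w _; exact: poweR_ge0.
rewrite muleA -EFinM -ge0_muleDl ?lee_fin; last 2 first.
- by rewrite mulr_ge0 ?divr_ge0 ?powR_ge0// ltW.
- exact: ltW.
rewrite -EFinD; apply: lee_pmul => //.
  by rewrite lee_fin addr_ge0 ?(ltW q0)// mulr_ge0 ?divr_ge0 ?powR_ge0// ltW.
rewrite lee_fin.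
have -> : (p ^+ 2 * r `^ (1 - p) * (r `^ p / p) = p * r)%R.
  transitivity (p * (r `^ (1 - p) * r `^ p))%R.
    by field; rewrite gt_eqF.
  rewrite -powRD; last by apply/implyP => _; rewrite gt_eqF.
  by rewrite subrK powRr1// ltW.
have : (0 <= (1 - p) * (r - 1))%R by rewrite mulr_ge0 ?subr_ge0// ltW.
by nra.
Qed.

End fixed_levels.

Lemma moment_transfer :
  \int[P]_(w in A) x w `^ p <= (p `^ (- p))%:E * \int[P]_(w in A) g w `^ p.
Proof.
have pp : (0 < p `^ p)%R by rewrite powR_gt0.
have I0 : 0 <= \int[P]_(w in A) g w `^ p by apply: integral_ge0 => w _; exact: poweR_ge0.
rewrite powRN.
suff : (p `^ p)%:E * \int[P]_(w in A) x w `^ p <= \int[P]_(w in A) g w `^ p.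
  move=> /(@lee_wpmul2l _ (p `^ p)^-1%:E).
  rewrite muleA -EFinM mulVf ?gt_eqF// mul1e; apply.
  by rewrite lee_fin invr_ge0 ltW.
case EI : (\int[P]_(w in A) g w `^ p) I0 => [I| |]// I0; last by rewrite leey.
rewrite lee_fin in I0.
apply/lee_addgt0Pr => e e0.
have e2 : (0 < e / 2)%R by rewrite divr_gt0.
(* Applied with the lower bound [(e/2)^(1/p)], whose power [p] is [e / 2], this ratio turns
   [r (I + e/2)] into [I + e]. *)
pose r := ((I + e) / (I + e / 2))%R.
have Ie : (0 < I + e / 2)%R by rewrite ltr_wpDl.
have r1 : (1 < r)%R by rewrite ltr_pdivlMr// mul1r ltrD2l; lra.
have h0 : (0 < (e / 2) `^ p^-1)%R by rewrite powR_gt0.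
have := moment_transfer_level r1 h0.
rewrite EI -powRrM mulVf ?gt_eqF// powRr1 ?(ltW e2)// => /le_trans; apply.
by rewrite -EFinD -EFinM lee_fin divfK// gt_eqF.
Qed.

End moment_transfer.

Section monotone_domination.
Context d (T : measurableType d) (R : realType) (P : probability T R).
Context (F : R -> set (set T)) (X G : R -> T -> R).

Lemma dominated_moment_inequality (p : R) : usual_conditions P F ->
  dominated_pair P F X G -> 0 < p -> p < 1 ->
  moment_inequality P F X G p (p `^ (- p)).
Proof.
move=> uF XG p0 p1; have fF := usual_filtration uF.
have [ndX X0 aX rX ndG G0 aG rG pG _] := XG.
have mX := adapted_measurable uF aX; have mG := adapted_measurable uF aG.
have sF0 := filtration_sigma fF (lexx 0).
have Fm0 := filtration_measurable fF (lexx 0).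
apply: (cond_exp_le_ae sF0 Fm0) => //.
- exact: powR_ge0.
- exact: measurable_sup_power.
- exact: measurable_sup_power.
- by move=> w; exact: poweR_ge0.
- by move=> w; exact: poweR_ge0.
move=> A FA; have mA := Fm0 _ FA.
apply: moment_transfer => //.
- exact: measurable_sup_process.
- exact: measurable_sup_process.
- by move=> w; exact: sup_process_ge0.
- by move=> w; exact: sup_process_ge0.
move=> c c0; apply: le_trans (integral_sup_never_reaches uF XG FA c0).
have mN : measurable (never_reaches G c) by exact: measurable_never_reaches uF _ ndG aG _.
apply: ge0_subset_integral.
- apply: measurableI => //; rewrite -[X in measurable X]setTI.
  apply: measurable_lte => //; exact: measurable_sup_process.
- exact: measurableI.
- by apply: measurable_funTS; exact: measurable_sup_process.
- by move=> w _; exact: sup_process_ge0.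
move=> w [Aw /= gc]; split => // t t0; rewrite -lte_fin.
exact: le_lt_trans (le_sup_process G w t0) gc.
Qed.

End monotone_domination.

(** * Sharpness *)

Section hitting_law.
Context (R : realType).

(** The probability of [xi = i + 1], as a difference of consecutive tails. *)
Definition law_weight (i : nat) : R := i.+1%:R^-1 - i.+2%:R^-1.

Lemma law_weightE i : law_weight i = (i.+1%:R * i.+2%:R)^-1.
Proof.
rewrite /law_weight -[i.+2%:R]natr1; field.
have i0 : 0 <= i%:R :> R by [].
by apply/andP; split; apply: lt0r_neq0; lra.
Qed.

Lemma law_weight_gt0 i : 0 < law_weight i.
Proof. by rewrite law_weightE invr_gt0 mulr_gt0. Qed.

Let law_weight_ge0 i : 0 <= law_weight i. Proof. exact/ltW/law_weight_gt0. Qed.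

(* The law of [xi - 1], where [P (xi > k) = 1 / (k + 1)]. *)
Definition hitting_law : set nat -> \bar R :=
  mseries (fun i => mscale (NngNum (law_weight_ge0 i)) (dirac i)) 0.

HB.instance Definition _ := Measure.on hitting_law.

Local Open Scope ereal_scope.

Lemma integral_hitting_law (f : nat -> R) : (forall i, (0 <= f i)%R) ->
  \int[hitting_law]_i (f i)%:E = \sum_(i <oo) (law_weight i * f i)%:E.
Proof.
move=> f0; have mf : measurable_fun [set: nat] (fun i => (f i)%:E) by [].
have f0' i : setT i -> 0 <= (f i)%:E by move=> _; rewrite lee_fin.
rewrite ge0_integral_measure_series//.
apply: eq_eseriesr => i _.
rewrite ge0_integral_mscale// integral_dirac//.
by rewrite diracT mul1e.
Qed.

(** The outcomes from [m] on have total mass [1/(m+1)], the weights being telescopic. The example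
    evaluated at a bounded stopping time is constant on such a tail, so its means become finite
    sums. *)
Lemma integral_hitting_law_cst (f : nat -> R) (c : R) (m : nat) :
  (forall i, (0 <= f i)%R) -> (forall i, (m <= i)%N -> f i = c) ->
  \int[hitting_law]_i (f i)%:E =
  (\sum_(0 <= i < m) law_weight i * f i + c / m.+1%:R)%:E.
Proof.
move=> f0 fc; rewrite integral_hitting_law//; apply: cvg_lim => //.
rewrite -(cvg_shiftn m).
have -> : (fun n => \sum_(0 <= i < n + m) (law_weight i * f i)%:E) =
    (fun n => (\sum_(0 <= i < m) law_weight i * f i + c * (m.+1%:R^-1 - (n + m).+1%:R^-1))%:E).
  apply/funext => n; rewrite sumEFin; congr EFin; elim: n => [|n IH].
    by rewrite add0n subrr mulr0 addr0.
  rewrite addSn big_nat_recr//= IH -addrA; congr +%R.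
  by rewrite fc ?leq_addl// /law_weight; ring.
apply: cvg_EFin; first exact: nearW.
rewrite /comp/=; apply: cvgD; first exact: cvg_cst.
apply: cvgM; first exact: cvg_cst.
rewrite -[X in _ --> X]subr0; apply: cvgB; first exact: cvg_cst.
have := @cvg_harmonic R; rewrite -(cvg_shiftn m).
exact.
Qed.

Let hitting_lawT : hitting_law setT = 1.
Proof.
rewrite -[LHS]mul1e -integral_cst//.
rewrite (@integral_hitting_law_cst (fun=> 1%R) 1%R 0%N)//.
by rewrite big_geq// add0r divr1.
Qed.

HB.instance Definition _ :=
  Measure_isProbability.Build _ _ _ hitting_law hitting_lawT.

(** Every outcome has positive mass. Negligible sets are therefore empty, and completeness of the
    filtration holds automatically. *)
Lemma hitting_law_eq0 (A : set nat) : hitting_law A = 0 -> A = set0.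
Proof.
move=> A0; apply/seteqP; split => // i Ai.
have : hitting_law [set i] <= 0 by rewrite -A0; apply: le_measure; rewrite ?inE// => _ ->.
have -> : hitting_law [set i] = \int[hitting_law]_j (\1_[set i] j : R)%:E.
  by rewrite integral_indic// setIT.
rewrite (@integral_hitting_law_cst _ 0%R i.+1)//; last first.
  move=> j ij; rewrite indicE memNset//= => ji.
  by move: ij; rewrite ji ltnn.
rewrite mul0r addr0 big_nat_recr//= indicE mem_set// mulr1 lee_fin leNgt => /negP; apply.
by rewrite ltr_wpDl ?law_weight_gt0// sumr_ge0// => j _; rewrite mulr_ge0.
Qed.

(* The filtration generated by the processes [\1_(xi <= t)], with [xi i = i + 1]. *)
Definition hitting_filtration (t : R) : set (set nat) :=
  [set A | forall i j, (t < i.+1%:R)%R -> (t < j.+1%:R)%R -> A i -> A j].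

Lemma hitting_filtration_usual : usual_conditions hitting_law hitting_filtration.
Proof.
have Fle s t : (s <= t)%R -> hitting_filtration s `<=` hitting_filtration t.
  by move=> st A FA i j ti tj; apply: FA; exact: le_lt_trans st _.
split; first split.
- move=> t t0; split => [//|A FA|A FA].
    move=> i j ti tj [_ Ai]; split => // Aj; apply: Ai; exact: FA tj ti Aj.
  by move=> i j ti tj [k _ Ai]; exists k => //; exact: FA ti tj Ai.
- by [].
- by move=> s t _; exact: Fle.
- move=> t t0; apply/seteqP; split => A FA; last by move=> s /= /ltW /Fle; apply.
  move=> i j ti tj Ai; pose m := Num.min i.+1%:R j.+1%:R : R.
  have tm : (t < m)%R by rewrite lt_min ti.
  have [tm1 tm2] := midf_lt tm.
  have mi : (m <= i.+1%:R)%R by rewrite ge_min lexx.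
  have mj : (m <= j.+1%:R)%R by rewrite ge_min lexx orbT.
  exact: FA _ tm1 i j (lt_le_trans tm2 mi) (lt_le_trans tm2 mj) Ai.
- move=> A [B [_ /hitting_law_eq0 -> AB]] i j _ _ /AB.
  by [].
Qed.

Lemma hitting_adapted (Y : R -> nat -> R) :
  (forall t i j, (0 <= t)%R -> (t < i.+1%:R)%R -> (t < j.+1%:R)%R -> Y t i = Y t j) ->
  adapted hitting_filtration Y.
Proof.
move=> YE t t0; have sF := filtration_sigma (usual_filtration hitting_filtration_usual) t0.
by apply/(measurable_wrtP sF) => B _ i j ti tj /=; rewrite (YE t i j).
Qed.

(** Before [xi] nothing is observed except that it has not come, so a stopping time that stops
    before [xi] does so at one deterministic time [t0]. Boundedness provides an outcome [k] on which
    this happens. *)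
Lemma hitting_stopping_time tau : bounded_stopping_time hitting_filtration tau ->
  exists t0, [/\ (0 <= t0)%R, forall i, (t0 < i.+1%:R)%R -> tau i = t0 &
    forall i, (i.+1%:R <= t0)%R -> (i.+1%:R <= tau i)%R].
Proof.
move=> [tau0 tauF [C tauC]].
pose k := Num.truncn C; have tk : (tau k < k.+1%:R)%R.
  exact: le_lt_trans (tauC k) (truncnS_gt C).
have early i : (tau i < i.+1%:R)%R -> tau i = tau k.
  move=> ti; apply/eqP; rewrite eq_le; apply/andP; split; rewrite leNgt; apply/negP => lt.
    have /= := tauF (tau k) (tau0 k) k i tk (lt_trans lt ti) (lexx _).
    by rewrite leNgt lt.
  have /= := tauF (tau i) (tau0 i) i k ti (lt_trans lt tk) (lexx _).
  by rewrite leNgt lt.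
exists (tau k); split => //.
  move=> i ki; apply: early; apply: le_lt_trans (ki).
  by have /= := tauF (tau k) (tau0 k) k i tk ki (lexx _).
move=> i ik; rewrite leNgt; apply/negP => ti.
by move: ik; rewrite -(early i ti) leNgt ti.
Qed.

End hitting_law.

(** * Dominated pairs stopped at a fixed time *)

Section stopped_pairs.
Context d (T : measurableType d) (R : realType) (P : probability T R).
Context (F : R -> set (set T)).
Hypothesis fF : filtration F.
Variable c : R.
Hypothesis c0 : 0 <= c.

Let min_ge0 (t : R) : 0 <= t -> 0 <= Num.min t c.
Proof. by move=> t0; rewrite le_min t0. Qed.

Lemma stopped_adapted (X : R -> T -> R) : adapted F X -> adapted F (stopped X c).
Proof.
move=> aX t t0.
have sF := filtration_sigma fF; have m0 := min_ge0 t0.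
apply/(measurable_wrtP (sF t t0)) => B mB.
apply: (filtration_nondecreasing fF m0); first by rewrite ge_min lexx.
exact: ((measurable_wrtP (sF _ m0) _).1 (aX _ m0)).
Qed.

Lemma stopped_right_continuous (X : R -> T -> R) : Defs.right_continuous X ->
  Defs.right_continuous (stopped X c).
Proof.
move=> rX t w t0; rewrite /stopped; have [ct|tc] := leP c t.
  apply: cvg_near_cst; near=> s; rewrite min_r// (le_trans ct)// ltW//.
apply: cvg_trans (rX t w t0); apply: near_eq_cvg; near=> s.
rewrite min_l// ltW//; near: s; exact: nbhs_right_lt.
Unshelve. all: by end_near. Qed.

Lemma stopped_left_continuous (X : R -> T -> R) : Defs.left_continuous X ->
  Defs.left_continuous (stopped X c).
Proof.
move=> lX t w t0; rewrite /stopped; have [tc|ct] := leP t c.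
  apply: cvg_trans (lX t w t0); apply: near_eq_cvg; near=> s.
  rewrite min_l// (le_trans _ tc)// ltW//; near: s; exact: nbhs_left_lt.
apply: cvg_near_cst; near=> s; rewrite min_r// ltW//.
Unshelve. all: by end_near. Qed.

Lemma left_continuous_predictable (X : R -> T -> R) : Defs.left_continuous X -> adapted F X ->
  predictable F X.
Proof. by move=> lX aX A XA; apply: sub_sigma_algebra; exists X. Qed.

(** The stopped processes at [tau] are the original ones at [min(tau, c)], again a bounded stopping
    time. Left continuity of [G] passes to the stopped process and yields its predictability. *)
Lemma stopped_dominated_pair (X G : R -> T -> R) : Defs.left_continuous G ->
  dominated_pair P F X G -> dominated_pair P F (stopped X c) (stopped G c).
Proof.
move=> lG [ndX X0 aX rX ndG G0 aG rG pG dom].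
have stopped_nd (Y : R -> T -> R) : Defs.nondecreasing Y -> Defs.nondecreasing (stopped Y c).
  move=> ndY s t w s0 st; apply: ndY; first exact: min_ge0.
  by rewrite le_min !ge_min lexx st orbT.
split.
- exact: stopped_nd.
- by move=> t w t0; apply: X0; exact: min_ge0.
- exact: stopped_adapted.
- exact: stopped_right_continuous.
- exact: stopped_nd.
- by move=> t w t0; apply: G0; exact: min_ge0.
- exact: stopped_adapted.
- exact: stopped_right_continuous.
- apply: left_continuous_predictable; first exact: stopped_left_continuous.
  exact: stopped_adapted.
move=> tau [tau0 tauF [C tauC]].
apply: (dom (fun w => Num.min (tau w) c)); split.
- by move=> w; exact: min_ge0.
- move=> t t0; have [ct|tc] := leP c t.
    rewrite (_ : [set _ | _] = setT).
      by case: (filtration_sigma fF t0) => F0 FC _; rewrite -[setT]setD0; exact: FC.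
    by apply/seteqP; split => // w _ /=; rewrite ge_min ct orbT.
  rewrite (_ : [set _ | _] = [set w | tau w <= t]); first exact: tauF.
  by apply/seteqP; split => w /=; rewrite ge_min [c <= t]leNgt tc orbF.
- by exists C => w; rewrite ge_min tauC.
Qed.

End stopped_pairs.

(** * The extremal pair and its moments *)

Section sharp_example.
Context (R : realType) (p : R).
Hypotheses (p0 : 0 < p) (p1 : p < 1).

Let a : R := p^-1.
Let a0 : 0 < a. Proof. by rewrite invr_gt0. Qed.

(** Young's inequality for [u] and 1 with exponents [1/p] and [1/(1-p)], multiplied by [a]. *)
Lemma powR_bernoulli (u : R) : 0 <= u -> 1 + a * (u - 1) <= u `^ a.
Proof.
move=> u0; have q0 : 0 < 1 - p by rewrite subr_gt0.
have := @conjugate_powR R u 1 a (1 - p)^-1 u0 ler01 a0.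
rewrite invr_gt0 /a !invrK => /(_ q0 (subrKC _ _)).
rewrite powR1 mulr1 mul1r -/a => h.
have -> : u `^ a = a * (u `^ a * p) by rewrite mulrCA /a mulVf ?mulr1// gt_eqF.
have -> : 1 + a * (u - 1) = a * (u - (1 - p)).
  by rewrite /a; field; rewrite gt_eqF.
by rewrite ler_pM2l//; lra.
Qed.

(** The hazard rate of [xi] at [k] is [1/(k+1)], and [G] grows from [k^a] to [(k+1)^a] over the
    preceding unit of time if [xi >= k]: the jump at [k] is at most this increment divided by the
    hazard rate. It follows from [powR_bernoulli] at [u = (k+1)/k]. *)
Lemma powR_succ_ge (k : R) : 0 < k -> a * k `^ a <= (k + 1) * ((k + 1) `^ a - k `^ a).
Proof.
move=> k0; have k1 : 0 < k + 1 by rewrite addr_gt0.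
have ka : 0 < k `^ a by rewrite powR_gt0.
have := @powR_bernoulli ((k + 1) / k) (ltW (divr_gt0 k1 k0)).
have -> : (k + 1) `^ a = ((k + 1) / k) `^ a * k `^ a.
  rewrite -powRM; [by rewrite divfK// gt_eqF|exact/ltW/divr_gt0|exact: ltW].
set v := (_ / k) `^ a; have -> : (k + 1) / k - 1 = k^-1.
  by field; rewrite gt_eqF.
move=> hv.
have -> : (k + 1) * (v * k `^ a - k `^ a) = ((k + 1) * (v - 1)) * k `^ a by ring.
rewrite ler_pM2r//.
apply: (@le_trans _ _ ((k + 1) * (a / k))); last by rewrite ler_pM2l//; lra.
rewrite mulrCA ler_peMr ?(ltW a0)//.
by rewrite ler_pdivlMr// mul1r lerDl.
Qed.

Definition dominating (t : R) (i : nat) : R := (Num.min t i.+1%:R + 1) `^ a.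

(* Makes the jump of height [a xi^a] at time [xi] continuous. *)
Definition dominated (t : R) (i : nat) : R :=
  a * i.+1%:R `^ a * Num.max 0 (Num.min 1 (t - i.+1%:R)).

Let jump_ge0 i : 0 <= a * i.+1%:R `^ a.
Proof. by rewrite mulr_ge0 ?powR_ge0// ltW. Qed.

Let base_gt0 (t : R) (i : nat) : 0 <= t -> 0 < Num.min t i.+1%:R + 1.
Proof. by move=> t0; rewrite ltr_wpDl// le_min t0/=. Qed.

Let base_ge0 (t : R) (i : nat) : 0 <= t -> 0 <= Num.min t i.+1%:R + 1.
Proof. by move=> /(base_gt0 i)/ltW. Qed.

Lemma dominating_nondecreasing : Defs.nondecreasing dominating.
Proof.
move=> s t i s0 st; have t0 := le_trans s0 st.
apply: ge0_ler_powR; rewrite ?nnegrE ?(ltW a0) ?base_ge0//.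
by rewrite lerD2r le_min !ge_min st lexx orbT.
Qed.

Lemma dominated_nondecreasing : Defs.nondecreasing dominated.
Proof.
move=> s t i s0 st; apply: ler_wpM2l => //.
rewrite ge_max !le_max lexx/=; apply/orP; right.
by rewrite le_min !ge_min lexx /= lerD2r st orbT.
Qed.

Lemma dominating_continuous i t : 0 <= t -> {for t, continuous (dominating ^~ i)}.
Proof.
move=> t0; have b0 := base_gt0 i t0.
have cm : {for t, continuous (fun s : R => Num.min s i.+1%:R + 1)}.
  apply: cvgD; last exact: cvg_cst.
  apply: (@continuous_min _ _ id (cst i.+1%:R)); [exact: cvg_id|exact: cst_continuous].
have cp : {for Num.min t i.+1%:R + 1, continuous (fun z : R => z `^ a)}.
  apply: differentiable_continuous; apply/derivable1_diffP.
  by apply: derivable_powR; rewrite in_itv/= b0.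
exact: (@continuous_comp _ _ _ (fun s : R => Num.min s i.+1%:R + 1) (fun z : R => z `^ a) t cm cp).
Qed.

Lemma dominated_continuous i : continuous (dominated ^~ i).
Proof.
move=> t; apply: cvgM; first exact: cvg_cst.
apply: (@continuous_max _ _ (cst 0) (fun s : R => Num.min 1 (s - i.+1%:R))).
  exact: cst_continuous.
apply: (@continuous_min _ _ (cst 1) (fun s : R => s - i.+1%:R)).
  exact: cst_continuous.
by apply: cvgB; [exact: cvg_id|exact: cvg_cst].
Qed.

Lemma dominating_left_continuous : Defs.left_continuous dominating.
Proof.
move=> t i t0; apply: cvg_at_left_filter.
exact: (@dominating_continuous i t (ltW t0)).
Qed.

Let dominating_adapted : adapted (@hitting_filtration R) dominating.
Proof.
apply: hitting_adapted => t i j t0 ti tj; rewrite /dominating.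
by rewrite !min_l// ltW.
Qed.

Let dominated_adapted : adapted (@hitting_filtration R) dominated.
Proof.
apply: hitting_adapted => t i j t0 ti tj; rewrite /dominated.
have z (k : nat) : t < k.+1%:R -> Num.max 0 (Num.min 1 (t - k.+1%:R)) = 0.
  by move=> tk; rewrite max_l// ge_min subr_le0 (ltW tk) orbT.
by rewrite !z// !mulr0.
Qed.

Let law_weight_ge0 i : 0 <= law_weight R i. Proof. exact/ltW/law_weight_gt0. Qed.

(** The means of the jumps up to the integer time [m] and of [G] at [m]. The induction step is
    [powR_succ_ge], weighted by the probability that [xi = m + 1]. *)
Let discrete_domination (m : nat) :
  \sum_(0 <= i < m) law_weight R i * (a * i.+1%:R `^ a) <=
  \sum_(0 <= i < m) law_weight R i * i.+2%:R `^ a + m.+1%:R `^ a / m.+1%:R.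
Proof.
elim: m => [|m IH].
  by rewrite !big_geq// add0r powR1 divr1.
rewrite !big_nat_recr//=.
have k0 : 0 < m.+1%:R :> R by [].
have := powR_succ_ge k0; rewrite natr1 => h.
suff hm : law_weight R m * (a * m.+1%:R `^ a) + m.+1%:R `^ a / m.+1%:R <=
    law_weight R m * m.+2%:R `^ a + m.+2%:R `^ a / m.+2%:R.
  apply: le_trans (lerD IH (lexx (law_weight R m * (a * m.+1%:R `^ a)))) _.
  by rewrite -!addrA lerD2l addrC.
rewrite law_weightE; set u := m.+1%:R `^ a in h *; set v := m.+2%:R `^ a in h *.
have k2 : m.+2%:R = m.+1%:R + 1 :> R by rewrite natr1.
rewrite k2 in h *; set k : R := m.+1%:R in k0 h *.
have k1 : 0 < k + 1 by rewrite addr_gt0.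
have kk : 0 < k * (k + 1) by rewrite mulr_gt0.
rewrite -(ler_pM2l kk).
have -> : k * (k + 1) * ((k * (k + 1))^-1 * (a * u) + u / k) = a * u + (k + 1) * u.
  by field; rewrite !gt_eqF.
have -> : k * (k + 1) * ((k * (k + 1))^-1 * v + v / (k + 1)) = v + k * v.
  by field; rewrite !gt_eqF.
by nra.
Qed.

Local Open Scope ereal_scope.

(** If [xi > t0], then [X] is still 0 and [G] equals [(t0 + 1)^a]; if [xi <= t0], then the ramp of
    [X] is at most 1, while [tau >= xi] makes [G] fully grown. Rounding [t0] down to the integer [m]
    reduces the claim to [discrete_domination]. *)
Let integral_domination tau : bounded_stopping_time (@hitting_filtration R) tau ->
  \int[hitting_law R]_i at_time dominated tau i <=
  \int[hitting_law R]_i at_time dominating tau i.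
Proof.
move=> tauS; have tau0 : forall i, (0 <= tau i)%R by case: tauS.
have [t0 [t00 early late]] := hitting_stopping_time tauS.
pose m := Num.truncn t0.
have /andP[mt tm] : (m%:R <= t0 < m.+1%:R)%R by exact: truncn_itv.
have ge_m (i : nat) : (m <= i)%N -> (t0 < i.+1%:R)%R.
  by move=> mi; apply: lt_le_trans tm _; rewrite ler_nat ltnS.
have lt_m (i : nat) : (i < m)%N -> (i.+1%:R <= t0)%R.
  by move=> im; apply: le_trans mt; rewrite ler_nat.
rewrite (@integral_hitting_law_cst _ _ 0%R m)//; last 2 first.
- by move=> i; rewrite mulr_ge0// le_max lexx.
- move=> i /ge_m ti; rewrite /dominated early// max_l ?mulr0//.
  by rewrite ge_min subr_le0 (ltW ti) orbT.
rewrite (@integral_hitting_law_cst _ _ ((t0 + 1) `^ a)%R m)//; last 2 first.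
- by move=> i; exact: powR_ge0.
- by move=> i /ge_m ti; rewrite /dominating early// min_l// ltW.
rewrite lee_fin mul0r addr0.
apply: (@le_trans _ _ (\sum_(0 <= i < m) law_weight R i * (a * i.+1%:R `^ a))%R).
  apply: ler_sum => i _; rewrite ler_wpM2l// ler_piMr//.
  by rewrite ge_max ler01 ge_min lexx.
apply: le_trans (discrete_domination m) _; apply: lerD.
  rewrite !big_nat; apply: ler_sum => i /andP[_ im].
  rewrite ler_wpM2l// /dominating min_r ?natr1//.
  exact/late/lt_m.
rewrite ler_pM2r ?invr_gt0//; apply: ge0_ler_powR; rewrite ?nnegrE ?(ltW a0)//.
  by rewrite addr_ge0.
by rewrite -natr1 lerD2r.
Qed.

Lemma example_dominated_pair :
  dominated_pair (hitting_law R) (@hitting_filtration R) dominated dominating.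
Proof.
have uF := hitting_filtration_usual R.
have fF := usual_filtration uF.
split.
- exact: dominated_nondecreasing.
- by move=> t i _; rewrite mulr_ge0// le_max lexx.
- exact: dominated_adapted.
- by move=> t i t0; apply: cvg_at_right_filter; exact: dominated_continuous.
- exact: dominating_nondecreasing.
- by move=> t i _; exact: powR_ge0.
- exact: dominating_adapted.
- by move=> t i t0; apply: cvg_at_right_filter; exact: dominating_continuous.
- apply: left_continuous_predictable => //; exact: dominating_left_continuous.
move=> tau tauS.
suff : \forall i \ae hitting_law R,
    cond_exp (hitting_law R) (hitting_filtration (0%R : R)) (at_time dominated tau) i <=
    1%:E * cond_exp (hitting_law R) (hitting_filtration (0%R : R)) (at_time dominating tau) i.
  by apply: filterS => i; rewrite mul1e.
apply: (cond_exp_le_ae (filtration_sigma fF (lexx 0%R)) (filtration_measurable fF (lexx 0%R))) => //.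
- by move=> i; rewrite lee_fin mulr_ge0// le_max lexx.
- by move=> i; rewrite lee_fin powR_ge0.
move=> A FA; rewrite mul1e.
(* As [xi >= 1], the sigma-algebra at time 0 is trivial, and conditional domination amounts to
   domination of the means. *)
have [->|/set0P[i Ai]] := eqVneq A set0; first by rewrite !integral_set0.
rewrite (_ : A = setT); first exact: integral_domination.
by apply/seteqP; split => // j _; exact: FA Ai.
Qed.

Let sup_stopped (Y : R -> nat -> R) (n : nat) i : Defs.nondecreasing Y ->
  sup_process (stopped Y n%:R) i = (Y n%:R i)%:E.
Proof.
move=> ndY; apply/eqP; rewrite eq_le; apply/andP; split.
  apply: ge_ereal_sup => _ [t] /[swap] <- /=; rewrite in_itv/= andbT => t0.
  rewrite lee_fin; apply: ndY; first by rewrite le_min t0/=.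
  by rewrite ge_min lexx orbT.
by apply: ereal_sup_ubound; exists n%:R; rewrite /= ?in_itv/= ?ler0n// /stopped minxx.
Qed.

Let stopped_sup_momentE (Y : R -> nat -> R) (n : nat) : Defs.nondecreasing Y ->
  stopped_sup_moment (hitting_law R) Y p n =
  \int[hitting_law R]_i (Y n%:R i `^ p)%:E.
Proof.
move=> ndY; apply: eq_integral => i _.
by rewrite /sup_power sup_stopped// poweR_EFin.
Qed.

Let H (n : nat) : R := series harmonic n.

(** The power [p] undoes the exponent [a], so this is the mean of [min (n, xi) + 1]. Below [n], the
    weight [1/((i+1)(i+2))] times [i + 2] is a harmonic term; the tail contributes 1. *)
Lemma example_moment_dominating n :
  stopped_sup_moment (hitting_law R) dominating p n = (H n + 1)%:E.
Proof.
have pE (x : R) : (0 <= x)%R -> ((x `^ a) `^ p = x)%R.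
  by move=> x0; rewrite -powRrM mulVf ?gt_eqF// powRr1.
rewrite stopped_sup_momentE; last exact: dominating_nondecreasing.
rewrite (@integral_hitting_law_cst _ (fun i => (dominating n%:R i `^ p)%R) n.+1%:R n); last 2 first.
- by move=> i; exact: powR_ge0.
- move=> i ni; rewrite /dominating pE ?base_ge0//.
  by rewrite min_l ?natr1// ler_nat leqW.
congr EFin; rewrite divff// /H /series/=; congr (_ + _)%R.
rewrite big_nat [RHS]big_nat; apply: eq_bigr => i /andP[_ ni].
rewrite /dominating pE ?base_ge0// min_r ?ler_nat// natr1 law_weightE.
by rewrite invfM -mulrA mulVf ?mulr1.
Qed.

(** At an integer time the ramp is either 0 or 1. As it takes a unit of time, at [n.+1] it is
    complete exactly when [xi <= n]. *)
Lemma example_moment_dominated n :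
  stopped_sup_moment (hitting_law R) dominated p n.+1 = (p `^ (- p) * (H n.+1 - 1))%:E.
Proof.
rewrite stopped_sup_momentE; last exact: dominated_nondecreasing.
rewrite (@integral_hitting_law_cst _ (fun i => (dominated n.+1%:R i `^ p)%R) 0%R n); last 2 first.
- by move=> i; exact: powR_ge0.
- move=> i ni; rewrite /dominated max_l ?mulr0 ?powR0 ?gt_eqF//.
  by rewrite ge_min subr_le0 ler_nat ltnS ni orbT.
congr EFin; rewrite mul0r addr0 /H /series/= big_nat_recl//= /harmonic/= invr1 addrAC subrr add0r.
rewrite mulr_sumr big_nat [RHS]big_nat; apply: eq_bigr => i /andP[_ ni].
have -> : dominated n.+1%:R i = (a * i.+1%:R `^ a)%R.
  rewrite /dominated min_l ?max_r ?mulr1//.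
  by rewrite lerBrDl natr1 ler_nat.
rewrite powRM ?powR_ge0 ?(ltW a0)// -powRrM mulVf ?gt_eqF// powRr1//.
have -> : (a `^ p = p `^ (- p))%R.
  by rewrite /a -powR_inv1 ?(ltW p0)// -powRrM mulN1r.
rewrite law_weightE mulrCA; congr (_ * _)%R.
by rewrite invfM mulrAC mulVf ?mul1r.
Qed.

Lemma example_ratio_cvg :
  (p `^ (- p) * (H n.+1 - 1) / (H n.+1 + 1))%R @[n --> \oo] --> (p `^ (- p))%R.
Proof.
have H0 n : (0 <= H n)%R by apply: sumr_ge0 => i _; exact: harmonic_ge0.
have Hdvg : H n @[n --> \oo] --> +oo%R.
  apply: nondecreasing_dvgn_lt; last exact: dvg_harmonic.
  by apply/nondecreasing_seqP => n; rewrite /H seriesSr lerDl harmonic_ge0.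
have H1dvg : (H n.+1 + 1)%R @[n --> \oo] --> +oo%R.
  apply: (@ger_cvgy _ _ _ _ (fun n => H n.+1)).
    by apply: nearW => n; rewrite lerDl.
  by rewrite (cvg_shiftS H).
have Hinv : ((H n.+1 + 1)^-1)%R @[n --> \oo] --> (0%R : R).
  by apply/gtr0_cvgV0 => //; apply: nearW => n; rewrite ltr_wpDl.
have -> : (fun n => p `^ (- p) * (H n.+1 - 1) / (H n.+1 + 1))%R =
    (fun n => p `^ (- p) * (1 - 2 * (H n.+1 + 1)^-1))%R.
  apply/funext => n; field.
  by rewrite gt_eqF// ltr_wpDl.
rewrite -[X in _ --> X]mulr1; apply: cvgM; first exact: cvg_cst.
rewrite -[X in _ --> X]subr0; apply: cvgB; first exact: cvg_cst.
rewrite -[X in _ --> X](mulr0 (2 : R)%R); apply: cvgM => //; exact: cvg_cst.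
Qed.

Lemma example_sharp : [/\ usual_conditions (hitting_law R) (@hitting_filtration R),
  dominated_pair (hitting_law R) (@hitting_filtration R) dominated dominating,
  continuous_paths dominated /\ continuous_paths dominating,
  \forall n \near \oo, 0 < stopped_sup_moment (hitting_law R) dominating p n < +oo
& (stopped_sup_moment (hitting_law R) dominated p n /
   stopped_sup_moment (hitting_law R) dominating p n) @[n --> \oo] --> (p `^ (- p))%:E].
Proof.
have H0 n : (0 <= H n)%R by apply: sumr_ge0 => i _; exact: harmonic_ge0.
split.
- exact: hitting_filtration_usual.
- exact: example_dominated_pair.
- split => i.
    by apply: continuous_subspaceT => t; exact: dominated_continuous.
  apply: continuous_in_subspaceT => t; rewrite inE/= in_itv/= andbT.
  exact: dominating_continuous.
- apply: nearW => n; rewrite example_moment_dominating lte_fin ltry andbT.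
  by rewrite ltr_wpDl.
rewrite -(cvg_shiftS (fun n => stopped_sup_moment (hitting_law R) dominated p n /
   stopped_sup_moment (hitting_law R) dominating p n)).
under eq_fun => n.
  rewrite example_moment_dominated example_moment_dominating inver gt_eqF ?ltr_wpDl// -EFinM.
  over.
apply: cvg_EFin; first exact: nearW.
exact: example_ratio_cvg.
Qed.

(** The unstopped [dominating] has a supremum with infinite [p]-th moment, which puts no constraint
    on [c]. The stopped pairs have finite moments, and their ratios tend to the constant. *)
Lemma sharp_constant (c : R) :
  (forall n : nat, moment_inequality (hitting_law R) (@hitting_filtration R)
     (stopped dominated n%:R) (stopped dominating n%:R) p c) -> (p `^ (- p) <= c)%R.
Proof.
move=> hc; have fF := usual_filtration (hitting_filtration_usual R).
have H0 n : (0 <= H n)%R by apply: sumr_ge0 => i _; exact: harmonic_ge0.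
(* A priori [c] may be negative, whereas [integral_le_of_cond_exp] takes a nonnegative constant. *)
suff : (p `^ (- p) <= Num.max c 0)%R.
  by rewrite le_max => /orP[//|]; rewrite leNgt powR_gt0.
have c0 : (0 <= Num.max c 0)%R by rewrite le_max lexx orbT.
apply: (cvgr_to_le example_ratio_cvg); apply: nearW => n.
rewrite ler_pdivrMr ?ltr_wpDl// -lee_fin [leRHS]EFinM.
rewrite -example_moment_dominated -example_moment_dominating.
have sF := filtration_sigma fF (lexx 0%R).
apply: (integral_le_of_cond_exp sF (filtration_measurable fF (lexx 0%R))) => //.
- by move=> i; exact: poweR_ge0.
- by move=> i; exact: poweR_ge0.
- apply: filterS (hc n.+1) => i /le_trans; apply.
  have W0 : forall i, 0 <= cond_exp (hitting_law R) (hitting_filtration (0%R : R))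
      (sup_power p (stopped dominating n.+1%:R)) i.
    pose U := sup_power p (stopped dominating n.+1%:R).
    have mU : measurable_fun setT U by [].
    have U0 i' : 0 <= U i' by exact: poweR_ge0.
    by have [_ + _] := cond_expP sF (filtration_measurable fF (lexx 0%R)) (hitting_law R) mU U0.
  by apply: lee_wpmul2r => //; rewrite lee_fin le_max lexx.
Qed.

End sharp_example.

Theorem theorem2p2 (R : realType) :
  (* (i) *)
  (forall (d : measure_display) (T : measurableType d) (P : probability T R)
      (F : R -> set (set T)) (X G : R -> T -> R),
    usual_conditions P F -> dominated_pair P F X G ->
    forall p : R, 0 < p -> p < 1 ->
      moment_inequality P F X G p (p `^ (- p))) /\
  (* (ii) *)
  (forall p : R, 0 < p -> p < 1 ->
    exists (d : measure_display) (T : measurableType d) (P : probability T R)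
      (F : R -> set (set T)) (X G : R -> T -> R),
      [/\ usual_conditions P F,
          dominated_pair P F X G,
          continuous_paths X /\ continuous_paths G,
          \forall n \near \oo, (0 < stopped_sup_moment P G p n < +oo)%E
        & (stopped_sup_moment P X p n / stopped_sup_moment P G p n)%E
            @[n --> \oo] --> (p `^ (- p))%:E]) /\
  (* sharpness *)
  (forall p : R, 0 < p -> p < 1 ->
    forall c : R,
      (forall (d : measure_display) (T : measurableType d)
          (P : probability T R) (F : R -> set (set T)) (X G : R -> T -> R),
        usual_conditions P F -> dominated_pair P F X G ->
        moment_inequality P F X G p c) ->
      p `^ (- p) <= c).
Proof.
split; first by move=> d T P F X G uF XG p; exact: dominated_moment_inequality.
split=> p p0 p1.
  exists _, nat, (hitting_law R), (@hitting_filtration R), (dominated p), (dominating p).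
  exact: example_sharp.
move=> c hc; apply: sharp_constant => // n.
have uF := hitting_filtration_usual R.
apply: hc => //; apply: stopped_dominated_pair; [exact: usual_filtration uF|by []| |].
- exact: dominating_left_continuous.
- exact: example_dominated_pair.
Qed.
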